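(* Consider a multiflow instance on a series-parallel digraph $G=(V,E)$, with commodities $i\in[k]$ given by source-sink pairs $(s_i,t_i)$ and demands $d_i$. (a) If all demands $d_i$, $i\in[k]$, are integers, then the vector of total arc flows $(x_e)_{e\in E}$ of any multiflow is a convex combination of vectors of total arc flows $(y_e)_{e\in E}$ of integer multiflows (for the same instance) each of which satisfies $$\lfloor x_e\rfloor\le y_e\le\lceil x_e\rceil\qquad\text{for every arc } e\in E.$$ (b) Given arc capacities $(c_e)_{e\in E}$, a feasible multiflow, if one exists, can be found efficiently through a single-commodity flow computation. Given integer arc capacities, a feasible integer multiflow, if one exists, can be found efficiently through a single-commodity flow computation.
   Context: Digraphs may have parallel arcs. A digraph $G=(V,E)$ is series-parallel if it has a designated start node $u_0$ and end node $v_0$ such that one of the following (recursively) holds: (1) $G$ consists of a single arc from $u_0$ to $v_0$; (2) (series composition) there are series-parallel digraphs $G_1=(V_1,E_1)$, $G_2=(V_2,E_2)$ with start/end nodes $u_1,v_1$ and $u_2,v_2$ such that $V=V_1\cup V_2$, $E$ is the disjoint union of $E_1$ and $E_2$, $u_0=u_1$, $v_1=u_2$, $v_0=v_2$, $V_1\cap V_2=\{v_1\}$; (3) (parallel composition) there are such $G_1,G_2$ with $V=V_1\cup V_2$, $E$ the disjoint union of $E_1$ and $E_2$, $u_0=u_1=u_2$, $v_0=v_1=v_2$, $V_1\cap V_2=\{u_0,v_0\}$. A multiflow instance on $G$ consists of $k$ commodities $i\in[k]=\{1,\dots,k\}$ with source-sink pairs $(s_i,t_i)\in V\times V$ and real demands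 $d_i>0$, where $s_i\ne t_i$ and $G$ contains an $s_i$–$t_i$ path for each $i$. A multiflow $X=(X_{e,i})_{e\in E,i\in[k]}$ consists of values $X_{e,i}\ge0$ such that for all $v\in V$, $i\in[k]$, $\sum_{e\in\delta^+(v)}X_{e,i}-\sum_{e\in\delta^-(v)}X_{e,i}$ equals $d_i$ if $v=s_i$, $-d_i$ if $v=t_i$, and $0$ otherwise ($\delta^+(v),\delta^-(v)$ are the sets of arcs leaving and entering $v$). It is an integer multiflow if all $X_{e,i}$ are integers. Its total (arc) flow is $x=(x_e)_{e\in E}$ with $x_e=\sum_{i\in[k]}X_{e,i}$. Given arc capacities $c_e\ge0$, $X$ is feasible if $x_e\le c_e$ for all $e\in E$. ''Efficiently'' means in polynomial time; ''through a single-commodity flow computation'' means that the task reduces in polynomial time to computing a single-commodity network flow ($b$-transshipment, i.e. a nonnegative arc vector with prescribed net outflow $b_v$ at each node $v$, respecting arc capacities, and integral in the integer case). *)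

(* Defs.v *)
From mathcomp Require Export all_boot all_order all_algebra.
From mathcomp Require Export reals.

Set Implicit Arguments.
Unset Strict Implicit.
Unset Printing Implicit Defensive.

Import Order.TTheory GRing.Theory Num.Theory.
Local Open Scope ring_scope.

(* Arcs are a type of their own, so parallel arcs are possible. *)
Record digraph (V E : finType) := Digraph { arc_from : E -> V; arc_to : E -> V }.

(* [sp_sub G u v W F]: the subgraph of [G] with node set [W] and arc set [F] is
   series-parallel with start node [u] and end node [v].  Digraphs may have
   parallel arcs but no loops, whence [arc_from G e != arc_to G e]. *)
Inductive sp_sub (V E : finType) (G : digraph V E) :
    V -> V -> {set V} -> {set E} -> Prop :=
| SpArc e of arc_from G e != arc_to G e :
    sp_sub G (arc_from G e) (arc_to G e) [set arc_from G e; arc_to G e] [set e]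
| SpSeries u w v V1 V2 E1 E2 of
    sp_sub G u w V1 E1 & sp_sub G w v V2 E2 &
    V1 :&: V2 = [set w] & [disjoint E1 & E2] :
    sp_sub G u v (V1 :|: V2) (E1 :|: E2)
| SpParallel u v V1 V2 E1 E2 of
    sp_sub G u v V1 E1 & sp_sub G u v V2 E2 &
    V1 :&: V2 = [set u; v] & [disjoint E1 & E2] :
    sp_sub G u v (V1 :|: V2) (E1 :|: E2).

Definition series_parallel (V E : finType) (G : digraph V E) (u0 v0 : V) : Prop :=
  sp_sub G u0 v0 [set: V] [set: E].

Definition has_path (V E : finType) (G : digraph V E) (s t : V) : bool :=
  connect (fun u v => [exists e, (arc_from G e == u) && (arc_to G e == v)]) s t.

Record commodity (R : Type) (V : Type) :=
  Commodity { source : V; sink : V; demand : R }.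

Definition multiflow_instance (R : realType) (V E : finType) (G : digraph V E)
    (k : nat) (K : 'I_k -> commodity R V) : Prop :=
  forall i, [/\ 0 < demand (K i), source (K i) != sink (K i) &
                has_path G (source (K i)) (sink (K i))].

Definition net_outflow (R : realType) (V E : finType) (G : digraph V E)
    (f : E -> R) (v : V) : R :=
  \sum_(e | arc_from G e == v) f e - \sum_(e | arc_to G e == v) f e.

Definition multiflow (R : realType) (V E : finType) (G : digraph V E)
    (k : nat) (K : 'I_k -> commodity R V) (X : E -> 'I_k -> R) : Prop :=
  (forall e i, 0 <= X e i) /\
  (forall i v, net_outflow G (X^~ i) v =
     if v == source (K i) then demand (K i)
     else if v == sink (K i) then - demand (K i) else 0).

Definition integer_multiflow (R : realType) (V E : finType) (G : digraph V E)
    (k : nat) (K : 'I_k -> commodity R V) (X : E -> 'I_k -> R) : Prop :=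
  multiflow G K X /\ (forall e i, X e i \is a Num.int).

Definition total_flow (R : realType) (E : finType) (k : nat)
    (X : E -> 'I_k -> R) (e : E) : R :=
  \sum_(i < k) X e i.

Definition feasible (R : realType) (E : finType) (k : nat)
    (c : E -> R) (X : E -> 'I_k -> R) : Prop :=
  forall e, total_flow X e <= c e.

Definition transshipment (R : realType) (V E : finType) (G : digraph V E)
    (b : V -> R) (c : E -> R) (f : E -> R) : Prop :=
  (forall e, 0 <= f e <= c e) /\ (forall v, net_outflow G f v = b v).

(* The model of computation is a first-order, call-by-value functional language
   on binary trees whose leaves are [Nil] or real numbers; every evaluation step
   costs 1.  On trees of [Nil]s (Jones' data type for WHILE programs)
   polynomially many steps are the same thing as polynomial time on a Turing
   machine.  Real numbers are opaque: they can only be added, subtracted and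
   compared.  There is no multiplication and no rounding, so each step lengthens
   the binary encoding over a common denominator by at most one bit.  A
   polynomial number of steps is therefore a strongly polynomial algorithm for
   real data and a polynomial-time algorithm, in the Turing sense, for rational
   data. *)
Inductive value (R : Type) :=
| Nil
| Pair of value R & value R
| Scalar of R.
Arguments Nil {R}.

(* Variables are de Bruijn indices.  [EMatch e0 e1 e2] evaluates [e1] if [e0]
   yields [Nil]; if [e0] yields [Pair a b], it evaluates [e2] with [a] bound to
   index 0 and [b] to index 1.  [EIfLe a b e1 e2] is "if a <= b then e1 else e2"
   on numbers.  Functions are unary and may be (mutually) recursive. *)
Inductive expr :=
| EVar of nat
| ENil
| EPair of expr & expr
| EZero
| EAdd of expr & expr
| ESub of expr & expr
| ELet of expr & expr
| EMatch of expr & expr & expr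
| EIfLe of expr & expr & expr & expr
| ECall of nat & expr.

(* A program is the list of its function bodies; function 0 is the entry point. *)
Definition program := seq expr.

(* [eval p env e a t]: in the environment [env], the expression [e] evaluates to
   [a] in [t] steps.  Ill-typed or diverging computations have no result. *)
Inductive eval (R : realType) (p : program) :
    seq (value R) -> expr -> value R -> nat -> Prop :=
| EvVar env i a of onth env i = Some a : eval p env (EVar i) a 1
| EvNil env : eval p env ENil Nil 1
| EvPair env e1 e2 a1 a2 t1 t2 of
    eval p env e1 a1 t1 & eval p env e2 a2 t2 :
    eval p env (EPair e1 e2) (Pair a1 a2) (t1 + t2).+1
| EvZero env : eval p env EZero (Scalar 0) 1
| EvAdd env e1 e2 x1 x2 t1 t2 of
    eval p env e1 (Scalar x1) t1 & eval p env e2 (Scalar x2) t2 :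
    eval p env (EAdd e1 e2) (Scalar (x1 + x2)) (t1 + t2).+1
| EvSub env e1 e2 x1 x2 t1 t2 of
    eval p env e1 (Scalar x1) t1 & eval p env e2 (Scalar x2) t2 :
    eval p env (ESub e1 e2) (Scalar (x1 - x2)) (t1 + t2).+1
| EvLet env e1 e2 a1 a2 t1 t2 of
    eval p env e1 a1 t1 & eval p (a1 :: env) e2 a2 t2 :
    eval p env (ELet e1 e2) a2 (t1 + t2).+1
| EvMatchNil env e0 e1 e2 a t0 t1 of
    eval p env e0 Nil t0 & eval p env e1 a t1 :
    eval p env (EMatch e0 e1 e2) a (t0 + t1).+1
| EvMatchPair env e0 e1 e2 a1 a2 a t0 t2 of
    eval p env e0 (Pair a1 a2) t0 & eval p [:: a1, a2 & env] e2 a t2 :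
    eval p env (EMatch e0 e1 e2) a (t0 + t2).+1
| EvIfLe env e1 e2 e3 e4 x1 x2 a t1 t2 t of
    eval p env e1 (Scalar x1) t1 & eval p env e2 (Scalar x2) t2 &
    eval p env (if x1 <= x2 then e3 else e4) a t :
    eval p env (EIfLe e1 e2 e3 e4) a (t1 + t2 + t).+1
| EvCall env f e body a1 a t1 t of
    eval p env e a1 t1 & onth p f = Some body & eval p [:: a1] body a t :
    eval p env (ECall f e) a (t1 + t).+1.

(* Evaluation shares subtrees, so a fast program could return an exponentially
   large tree; [runs] also bounds the size of the output when written out. *)
Fixpoint value_size (R : Type) (a : value R) : nat :=
  if a is Pair a1 a2 then (value_size a1 + value_size a2).+1 else 1.

Definition runs (R : realType) (p : program) (input output : value R)
    (bound : nat) : Prop :=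
  exists t, [/\ eval p [:: input] (ECall 0 (EVar 0)) output t,
                (t <= bound)%N & (value_size output <= bound)%N].

Definition enc_seq (R : Type) (s : seq (value R)) : value R :=
  foldr (@Pair R) Nil s.

(* Numbers of nodes are encoded in unary, hence polynomially in the size of the
   digraph. *)
Definition enc_nat (R : Type) (n : nat) : value R := enc_seq (nseq n Nil).

Definition enc_arcs (R : Type) (n m : nat) (G : digraph 'I_n 'I_m)
    (c : 'I_m -> R) : value R :=
  enc_seq [seq Pair (enc_nat R (arc_from G e))
                    (Pair (enc_nat R (arc_to G e)) (Scalar (c e))) | e : 'I_m].

Definition enc_multiflow_instance (R : Type) (n m k : nat)
    (G : digraph 'I_n 'I_m) (u0 v0 : 'I_n) (K : 'I_k -> commodity R 'I_n)
    (c : 'I_m -> R) : value R :=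
  enc_seq
    [:: enc_nat R n; enc_nat R u0; enc_nat R v0; enc_arcs G c;
        enc_seq [seq Pair (enc_nat R (source (K i)))
                          (Pair (enc_nat R (sink (K i))) (Scalar (demand (K i))))
                | i : 'I_k]].

Definition enc_flow_instance (R : Type) (n m : nat) (G : digraph 'I_n 'I_m)
    (b : 'I_n -> R) (c : 'I_m -> R) : value R :=
  Pair (enc_seq [seq Scalar (b v) | v : 'I_n]) (enc_arcs G c).

Definition enc_flow (R : Type) (m : nat) (f : 'I_m -> R) : value R :=
  enc_seq [seq Scalar (f e) | e : 'I_m].

Definition enc_multiflow (R : Type) (m k : nat) (X : 'I_m -> 'I_k -> R) : value R :=
  enc_seq [seq enc_flow (X e) | e : 'I_m].

(* The numbers in [S] are the admissible ones: all reals for the fractional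
   problem, the integers for the integral problem.  The program [P] turns the
   given instance into a single-commodity flow instance, which is solvable if the
   multiflow problem is; the program [Q] turns an arbitrary solution of the
   former (whatever flow algorithm provided it) into a solution of the latter.
   In particular the multiflow problem is infeasible whenever the
   single-commodity problem is.  Both run in polynomial time in the size of the
   given instance. *)
Definition found_through_single_flow (R : realType) (S : pred R) : Prop :=
  exists (P Q : program) (C : nat),
  forall (n m k : nat) (G : digraph 'I_n 'I_m) (u0 v0 : 'I_n)
         (K : 'I_k -> commodity R 'I_n) (c : 'I_m -> R),
  series_parallel G u0 v0 -> multiflow_instance G K ->
  (forall e, 0 <= c e /\ S (c e)) ->
  let inst := enc_multiflow_instance G u0 v0 K c in
  let bound := (C * value_size inst ^ C)%N in
  exists (n' m' : nat) (H : digraph 'I_n' 'I_m') (b : 'I_n' -> R) (c' : 'I_m' -> R),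
  [/\ runs P inst (enc_flow_instance H b c') bound,
      forall e, 0 <= c' e /\ S (c' e),
      (exists X, [/\ multiflow G K X, feasible c X & forall e i, S (X e i)]) ->
        exists f, transshipment H b c' f /\ (forall e, S (f e)) &
      forall f, transshipment H b c' f -> (forall e, S (f e)) ->
        exists X, [/\ multiflow G K X, feasible c X, forall e i, S (X e i) &
                      runs Q (Pair inst (enc_flow f)) (enc_multiflow X) bound]].

(* Main.v *)
(** Parallel arcs can be merged, and so can the two arcs at a node with exactly
one entering and one leaving arc.  A series-parallel digraph shrinks to a single
arc under these two reductions, in whatever order they are applied, because they
commute.

Replace the source-sink pairs by arbitrary demand vectors [b i], one for each
commodity.  Then both reductions preserve the set of multiflows.  When the node
[w] between the arcs [e] and [f] disappears, [e] has to carry at least the deficit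
[max(0, - b i w)] and [f] at least the surplus [max(0, b i w)] of commodity [i];
what remains on [e] and [f] is the same flow, and it is the flow of the merged
arc.  When two parallel arcs are merged, any split of the total that respects the
capacities will do.

For (a), choose an offset [o e] for every arc and round [x e] to
[floor (o e + x e + t) - floor (o e + t)].  Series arcs get the same offset and
parallel arcs consecutive ones, so that for every [t] the rounded vector is again
the total flow of an integer multiflow.  It lies between the two roundings of [x],
and its mean over [t] in [0, 1) is [x].

For (b), undoing the reductions one after the other finds a feasible multiflow
with additions, subtractions and comparisons only, or shows that there is none. *)

Require Import Defs.
From mathcomp Require Import ring lra zify.
Set Implicit Arguments.
Unset Strict Implicit.
Unset Printing Implicit Defensive.
Import Order.TTheory GRing.Theory Num.Theory.
Local Open Scope ring_scope.

(** * Series and parallel reductions *)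

(** Contracting a node pushes its demand onto the two neighbours, so a commodity does not remain a
    source-sink pair; this forces the general demand vectors. The amounts forced on the two arcs
    depend on the demands alone. They are known before any flow is, and can be charged against the
    capacities on the way down: the merged arc gets the smaller of the two residual capacities. The
    program sees a list of arcs and no decomposition tree. It contracts the first suitable pair that
    it meets, and confluence guarantees that it cannot be stuck before one arc is left. There the
    flow has to be the demand at the tail. The only freedom is the split at a parallel pair, and a
    greedy split serves both parts: in (a) up to the rounded total of the first arc, in (b) up to
    its capacity. In (a) the same [t] is used on all arcs, so one average treats them all at once.
    On [0, 1) each of the finitely many floors jumps at most once, so finitely many values of [t]
    with suitable weights replace the integral. *)

Section Reduction.
Variable V : eqType.
Implicit Types (x y w z u v : V) (L M : seq (V * V)).

Definition touches w L := has (fun a => (a.1 == w) || (a.2 == w)) L.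

Lemma touches_perm w L M : perm_eq L M -> touches w L = touches w M.
Proof. by move=> LM; rewrite /touches !has_count; move/permP: LM => ->. Qed.

(** Lists stand for multisets of arcs, hence the permutation in each rule. [~~ touches w M] leaves
    [w] with just one entering and one leaving arc. *)
Inductive reducible : seq (V * V) -> Prop :=
| RedArc x y of x != y : reducible [:: (x, y)]
| RedPar x y L M of perm_eq L [:: (x, y), (x, y) & M] &
    reducible ((x, y) :: M) : reducible L
| RedSer x w y L M of perm_eq L [:: (x, w), (w, y) & M] &
    x != w & w != y & ~~ touches w M & reducible ((x, y) :: M) : reducible L.

Lemma reducible_perm L M : perm_eq L M -> reducible L -> reducible M.
Proof.
move=> LM redL; case: redL LM => [x y xy|x y {}L L' LL' r|x w y {}L L' LL' xw wy wL' r] LM.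
- by move: LM; rewrite perm_sym => /perm_small_eq -> //; constructor.
- by apply: (RedPar _ r); rewrite perm_sym in LM; apply: perm_trans LM LL'.
- by apply: (RedSer _ xw wy wL' r); rewrite perm_sym in LM; apply: perm_trans LM LL'.
Qed.

(** The last arc is no loop, and undoing a reduction creates none. Consequently no step of a
    derivation contracts an antiparallel pair, which would leave a loop. *)
Lemma reducible_loopless L a : reducible L -> a \in L -> a.1 != a.2.
Proof.
move=> redL; elim: redL a => {L} [x y xy|x y L M /perm_mem LM _ IH|x w y L M /perm_mem LM xw wy _ _ IH] a.
- by rewrite inE => /eqP ->.
- rewrite LM !inE => /or3P[/eqP->|/eqP->|aM]; apply: IH; rewrite !inE ?eqxx //.
  by rewrite aM orbT.
- rewrite LM !inE => /or3P[/eqP->|/eqP->|aM] //; apply: IH; rewrite !inE ?eqxx //.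
  by rewrite aM orbT.
Qed.

Lemma perm_cons2_exchange (T : eqType) (a c : T) (s t : seq T) :
  a != c -> perm_eq (a :: s) (c :: t) ->
  exists2 r, perm_eq s (c :: r) & perm_eq t (a :: r).
Proof.
move=> ac st.
have cs : c \in s.
  have : c \in a :: s by rewrite (perm_mem st) mem_head.
  by rewrite inE eq_sym (negPf ac).
exists (rem c s); first exact: perm_to_rem.
rewrite -(perm_cons c) perm_sym; apply: perm_trans st.
rewrite -[c :: a :: _]/([:: c] ++ [:: a] ++ _) perm_catCA /= perm_cons perm_sym.
exact: perm_to_rem.
Qed.

Lemma perm_swap (T : eqType) (a b : T) s : perm_eq (a :: b :: s) (b :: a :: s).
Proof. by rewrite -[a :: b :: s]/([:: a] ++ [:: b] ++ s) perm_catCA. Qed.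

Lemma perm_cons_congr (T : eqType) (a : T) (s t : seq T) :
  perm_eq s t -> perm_eq (a :: s) (a :: t).
Proof. by rewrite perm_cons. Qed.

Lemma perm_cons4_exchange (T : eqType) (a b c d : T) (s t : seq T) :
  a != c -> a != d -> b != c -> b != d ->
  perm_eq [:: a, b & s] [:: c, d & t] ->
  exists2 r, perm_eq s [:: c, d & r] & perm_eq t [:: a, b & r].
Proof.
move=> ac ad bc bd st.
have [r1 s1 t1] := perm_cons2_exchange ac st.
have [r2 s2 t2] := perm_cons2_exchange bc s1.
have ad' : d != a by rewrite eq_sym.
have [r3 s3 t3] := perm_cons2_exchange ad' t1.
have [r4 s4 t4] : exists2 r4, perm_eq r2 (d :: r4) & perm_eq r3 (b :: r4).
  apply: (perm_cons2_exchange bd); apply: perm_trans t3; rewrite perm_sym //.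
exists r4.
  by apply: perm_trans s2 _; rewrite perm_cons.
by apply: perm_trans s3 _; rewrite perm_cons.
Qed.

Lemma touches_cons w a L :
  touches w (a :: L) = [|| a.1 == w, a.2 == w | touches w L].
Proof. by rewrite /touches /= orbA. Qed.

Lemma touchesN_neq w a L : ~~ touches w L -> a \in L -> (a.1 != w) && (a.2 != w).
Proof. by move/hasPn => h /h; rewrite negb_or. Qed.

Lemma in_perm2 (T : eqType) (a b : T) s t :
  perm_eq s [:: a, b & t] -> (a \in s) * (b \in s).
Proof. by move=> /perm_mem st; rewrite !st !inE !eqxx ?orbT. Qed.

(* Two reductions of the same list commute, or lead to the same list. *)
Lemma reducible_confluent L : reducible L ->
  (forall x y M, perm_eq L [:: (x, y), (x, y) & M] -> reducible ((x, y) :: M)) /\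
  (forall x w y M, perm_eq L [:: (x, w), (w, y) & M] -> ~~ touches w M ->
     reducible ((x, y) :: M)).
Proof.
move=> redL.
have lL := reducible_loopless redL.
elim: redL lL => {L} [x y xy|x' y' L M' LM' r IH|x' w' y' L M' LM' xw' wy' wM' r IH] lL.
- by split=> [x1 y1 M /perm_size|x1 w1 y1 M /perm_size].
- have {IH}[IHp IHs] := IH (fun a => reducible_loopless r).
  split=> [x y M LM|x w y M LM wM].
    have E : perm_eq [:: (x, y), (x, y) & M] [:: (x', y'), (x', y') & M'].
      by rewrite -(permPl LM).
    have [e|ne] := eqVneq (x, y) (x', y').
      move: E; rewrite e !perm_cons => E.
      by apply: reducible_perm r; rewrite perm_cons perm_sym.
    have [r4 s4 t4] := perm_cons4_exchange ne ne ne ne E.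
    apply: (@RedPar x' y' _ ((x, y) :: r4)).
      apply: (perm_trans (perm_cons_congr (x, y) s4)).
      by apply: (perm_trans (perm_swap _ _ _)); rewrite perm_cons perm_swap.
    apply: reducible_perm (perm_swap _ _ _) _; apply: IHp.
    apply: (perm_trans (perm_cons_congr (x', y') t4)).
    by apply: (perm_trans (perm_swap _ _ _)); rewrite perm_cons perm_swap.
  have E : perm_eq [:: (x, w), (w, y) & M] [:: (x', y'), (x', y') & M'].
    by rewrite -(permPl LM).
  have [/lL/= xw /lL/= wy] := in_perm2 LM.
  (* If an arc of the series pair were one of the parallel arcs, its twin would lie in [M] and touch
     [w]. *)
  have n1 : (x, w) != (x', y').
    apply/eqP=> e; move: E; rewrite -e perm_cons => /perm_mem/(_ (x, w)).
    rewrite mem_head inE xpair_eqE (negPf xw) /= => /(touchesN_neq wM).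
    by rewrite eqxx andbF.
  have n2 : (w, y) != (x', y').
    apply/eqP=> e; move: E.
    rewrite (permPl (perm_swap _ _ _)) -e perm_cons => /perm_mem/(_ (w, y)).
    rewrite mem_head inE xpair_eqE [w == x]eq_sym (negPf xw) /= => /(touchesN_neq wM).
    by rewrite eqxx.
  have [r4 s4 t4] := perm_cons4_exchange n1 n1 n2 n2 E.
  move: wM; rewrite (touches_perm _ s4) !touches_cons.
  case/norP=> n3 /norP[n4] /norP[_ /norP[_ n5]].
  apply: (@RedPar x' y' _ ((x, y) :: r4)).
    apply: (perm_trans (perm_cons_congr (x, y) s4)).
    by apply: (perm_trans (perm_swap _ _ _)); rewrite perm_cons perm_swap.
  apply: reducible_perm (perm_swap _ _ _) _; apply: (IHs x w y).
    apply: (perm_trans (perm_cons_congr (x', y') t4)).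
    by apply: (perm_trans (perm_swap _ _ _)); rewrite perm_cons perm_swap.
  by rewrite touches_cons negb_or n3 negb_or n4.
have {IH}[IHp IHs] := IH (fun a => reducible_loopless r).
split=> [x y M LM|x w y M LM wM].
  have E : perm_eq [:: (x, y), (x, y) & M] [:: (x', w'), (w', y') & M'].
    by rewrite -(permPl LM).
  have n1 : (x, y) != (x', w').
    apply/eqP=> e; move: E; rewrite e perm_cons => /perm_mem/(_ (x', w')).
    rewrite mem_head inE xpair_eqE (negPf xw') /= => /esym /(touchesN_neq wM').
    by rewrite eqxx andbF.
  have n2 : (x, y) != (w', y').
    apply/eqP=> e; move: E.
    rewrite perm_sym (permPl (perm_swap _ _ _)) -e perm_cons => /perm_mem/(_ (x, y)).
    rewrite mem_head inE.
    case: e => -> ->; rewrite xpair_eqE eq_sym (negPf xw') /= => /(touchesN_neq wM').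
    by rewrite eqxx.
  have [r4 s4 t4] := perm_cons4_exchange n1 n2 n1 n2 E.
  move: wM'; rewrite (touches_perm _ t4) !touches_cons.
  case/norP=> n3 /norP[n4] /norP[_ /norP[_ n5]].
  apply: (@RedSer x' w' y' _ ((x, y) :: r4)) => //.
    apply: (perm_trans (perm_cons_congr (x, y) s4)).
    by apply: (perm_trans (perm_swap _ _ _)); rewrite perm_cons perm_swap.
    by rewrite touches_cons !negb_or n3 n4.
  apply: reducible_perm (perm_swap _ _ _) _; apply: IHp.
  apply: (perm_trans (perm_cons_congr (x', y') t4)).
  by apply: (perm_trans (perm_swap _ _ _)); rewrite perm_cons perm_swap.
have E : perm_eq [:: (x, w), (w, y) & M] [:: (x', w'), (w', y') & M'].
  by rewrite -(permPl LM).
have [/lL/= xw /lL/= wy] := in_perm2 LM.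
(* With the same middle node both steps contract the only two arcs there, so the results
   coincide. *)
have [ew|nw] := eqVneq w w'.
  subst w'.
  have ein : (x, w) = (x', w).
    apply/eqP; have: (x, w) \in [:: (x', w), (w, y') & M'].
      by rewrite -(perm_mem E) mem_head.
    rewrite !inE => /or3P[//||/(touchesN_neq wM')]; last by rewrite eqxx andbF.
    by rewrite xpair_eqE (negPf xw).
  have eout : (w, y) = (w, y').
    apply/eqP; have: (w, y) \in [:: (x', w), (w, y') & M'].
      by rewrite -(perm_mem E) !inE eqxx orbT.
    rewrite !inE => /or3P[|//|/(touchesN_neq wM')]; last by rewrite eqxx.
    by rewrite xpair_eqE [y == w]eq_sym (negPf wy) andbF.
  move: E r; rewrite ein eout !perm_cons => E r.
  case: ein => ->; case: eout => ->.
  by apply: reducible_perm r; rewrite perm_cons perm_sym.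
have n1 : (x, w) != (x', w') by rewrite xpair_eqE (negPf nw) andbF.
have n4 : (w, y) != (w', y') by rewrite xpair_eqE (negPf nw).
(* The contractions share an arc: the path runs through [x'], [w'], [w], [y], and either order ends
   with the arc [(x', y)]. The mirror image of this case follows below. *)
have [e2|n2] := eqVneq (x, w) (w', y').
  case: e2 => ? ?; subst x y'.
  move: E; rewrite perm_sym (permPl (perm_swap _ _ _)) perm_cons => E.
  have [r4 s4 t4] : exists2 r4, perm_eq M' ((w, y) :: r4) & perm_eq M ((x', w') :: r4).
    apply: (perm_cons2_exchange _ E).
    rewrite xpair_eqE negb_and; apply/orP.
    (* The outer two arcs can coincide only on an antiparallel pair, whose contraction would be a
       loop. *)
    have [e|?] := eqVneq x' w; last by left.
    right; apply/negP=> /eqP e'; move: (reducible_loopless r (mem_head _ _)).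
    by rewrite /= e eqxx.
  move: wM; rewrite (touches_perm _ t4) touches_cons => /norP[n5 /norP[n6 n7]].
  move: wM'; rewrite (touches_perm _ s4) touches_cons => /norP[n8 /norP[n9 n10]].
  apply: (@RedSer x' w' y _ r4) => //; last first.
  - apply: (IHs x' w y); last by [].
    by rewrite perm_cons.
  - by rewrite eq_sym.
  - apply: (perm_trans (perm_cons_congr _ t4)); exact: perm_swap.
have [e3|n3] := eqVneq (w, y) (x', w').
  case: e3 => ? ?; subst x' y.
  move: E; rewrite (permPl (perm_swap _ _ _)) perm_cons => E.
  have [r4 s4 t4] : exists2 r4, perm_eq M ((w', y') :: r4) & perm_eq M' ((x, w) :: r4).
    apply: (perm_cons2_exchange _ E).
    rewrite xpair_eqE negb_and; apply/orP.
    have [e|?] := eqVneq x w'; last by left.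
    right; apply/negP=> /eqP e'; move: (reducible_loopless r (mem_head _ _)).
    by rewrite /= e' eqxx.
  move: wM; rewrite (touches_perm _ s4) touches_cons => /norP[n5 /norP[n6 n7]].
  move: wM'; rewrite (touches_perm _ t4) touches_cons => /norP[n8 /norP[n9 n10]].
  apply: (@RedSer x w' y' _ r4) => //; last first.
  - apply: (IHs x w y'); last by [].
    by apply: (perm_trans (perm_cons_congr _ t4)); exact: perm_swap.
  - by rewrite perm_cons.
have [r4 s4 t4] := perm_cons4_exchange n1 n2 n3 n4 E.
move: wM; rewrite (touches_perm _ s4) !touches_cons.
case/norP=> n5 /norP[n6] /norP[n7 /norP[n8 n9]].
move: wM'; rewrite (touches_perm _ t4) !touches_cons.
case/norP=> m5 /norP[m6] /norP[m7 /norP[m8 m9]].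
apply: (@RedSer x' w' y' _ ((x, y) :: r4)) => //.
- apply: (perm_trans (perm_cons_congr (x, y) s4)).
  by apply: (perm_trans (perm_swap _ _ _)); rewrite perm_cons perm_swap.
- by rewrite touches_cons !negb_or m5 m8.
apply: reducible_perm (perm_swap _ _ _) _; apply: (IHs x w y).
  apply: (perm_trans (perm_cons_congr (x', y') t4)).
  by apply: (perm_trans (perm_swap _ _ _)); rewrite perm_cons perm_swap.
by rewrite touches_cons !negb_or n5 n8.
Qed.

End Reduction.

(** * Series-parallel digraphs are reducible *)

Section SeriesParallelReducible.
Variables (V E : finType) (G : digraph V E).

Definition ends e := (arc_from G e, arc_to G e).

Lemma sp_sub_nodes u v W F : sp_sub G u v W F ->
  [/\ u != v, u \in W, v \in W &
      forall w, touches w [seq ends e | e <- enum F] -> w \in W].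
Proof.
elim=> {u v W F} [e ne|u w v V1 V2 E1 E2 _ [n1 u1 v1 t1] _ [n2 u2 v2 t2] V12 _
  |u v V1 V2 E1 E2 _ [n1 u1 v1 t1] _ [n2 u2 v2 t2] _ _].
- split; rewrite ?inE ?eqxx ?orbT // => w /hasP[_ /mapP[e' + ->]].
  by rewrite mem_enum !inE => /eqP -> /=; rewrite ![w == _]eq_sym.
- split; rewrite ?inE ?u1 ?v2 ?orbT //; last first.
    move=> z /hasP[_ /mapP[e + ->] ez]; rewrite mem_enum !inE => /orP[e1|e2].
      by rewrite t1 //; apply/hasP; exists (ends e) => //; rewrite map_f ?mem_enum.
    by rewrite t2 ?orbT //; apply/hasP; exists (ends e) => //; rewrite map_f ?mem_enum.
  (* A common value of [u] and [v] would lie in both parts, hence be [w]. *)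
  apply: contra n1 => /eqP uv.
  by have := in_setI u V1 V2; rewrite V12 u1 uv v2 inE -uv => ->.
- split; rewrite ?inE ?u1 ?v2 ?orbT // => z /hasP[_ /mapP[e + ->] ez].
  rewrite mem_enum !inE => /orP[e1|e2].
    by rewrite t1 //; apply/hasP; exists (ends e) => //; rewrite map_f ?mem_enum.
  by rewrite t2 ?orbT //; apply/hasP; exists (ends e) => //; rewrite map_f ?mem_enum.
Qed.

Lemma enum_disjointU (A B : {set E}) : [disjoint A & B] ->
  perm_eq (enum (A :|: B)) (enum A ++ enum B).
Proof.
move=> dAB; apply: uniq_perm; first exact: enum_uniq.
  rewrite cat_uniq !enum_uniq andbT /=; apply/hasPn=> e.
  by rewrite !mem_enum; apply: contraL => /(disjointFr dAB) ->.
by move=> e; rewrite mem_cat !mem_enum inE.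
Qed.

Lemma touches_cat (w : V) L M : touches w (L ++ M) = touches w L || touches w M.
Proof. exact: has_cat. Qed.

(* A series-parallel part meeting the rest [M] of the digraph only in its end
   nodes can be reduced to a single arc without looking at [M]. *)
Lemma sp_sub_reducible_context u v W F : sp_sub G u v W F -> forall M,
  (forall w, w \in W -> touches w M -> w = u \/ w = v) ->
  reducible ((u, v) :: M) -> reducible ([seq ends e | e <- enum F] ++ M).
Proof.
elim=> {u v W F} [e ne|u w v V1 V2 E1 E2 s1 IH1 s2 IH2 V12 dE|u v V1 V2 E1 E2 s1 IH1 s2 IH2 V12 dE] M MW r.
- by rewrite enum_set1.
- have V12E z : z \in V1 -> z \in V2 -> z = w.
    by move=> z1 z2; apply/set1P; rewrite -V12 inE z1.
  have [n1 u1 w1 t1] := sp_sub_nodes s1; have [n2 w2 v2 t2] := sp_sub_nodes s2.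
  (* [E1] is reduced with [E2] in its context, then [E2] with the new arc [(u, w)] in its context;
     finally [w] is contracted, which [M] avoids because [w] is no end node of the whole part. *)
  apply: (@reducible_perm _ ([seq ends e | e <- enum E1] ++ [seq ends e | e <- enum E2] ++ M)).
    by rewrite catA -map_cat perm_cat2r perm_sym perm_map // enum_disjointU.
  apply: IH1 => [z z1|].
    rewrite touches_cat => /orP[/t2/(V12E _ z1)|zM]; first by right.
    have [||e] := MW z _ zM; [by rewrite inE z1|by left|right].
    by apply: V12E => //; rewrite e.
  apply: (@reducible_perm _ ([seq ends e | e <- enum E2] ++ (u, w) :: M)).
    by rewrite -cat_rcons -[_ :: _ ++ _]/([:: (u, w)] ++ _) catA perm_cat2r perm_rcons.
  apply: IH2 => [z z2|].
    rewrite touches_cons /= => /or3P[/eqP e|/eqP e|zM]; [left|by left|].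
      by apply: V12E => //; rewrite -e.
    have [|e|] := MW z _ zM; [by rewrite inE z2 orbT|left|by right].
    by apply: V12E => //; rewrite e.
  apply: (RedSer _ n1 n2 _ r); first exact: perm_swap.
  apply/negP=> /MW; rewrite inE w1 => /(_ isT)[e|e]; first by rewrite e eqxx in n1.
  by rewrite e eqxx in n2.
- have V12E z : z \in V1 -> z \in V2 -> z = u \/ z = v.
    by move=> z1 z2; apply/set2P; rewrite -V12 inE z1.
  have [_ _ _ t2] := sp_sub_nodes s2.
  apply: (@reducible_perm _ ([seq ends e | e <- enum E1] ++ [seq ends e | e <- enum E2] ++ M)).
    by rewrite catA -map_cat perm_cat2r perm_sym perm_map // enum_disjointU.
  apply: IH1 => [z z1|].
    by rewrite touches_cat => /orP[/t2/(V12E _ z1)//|]; apply: MW; rewrite inE z1.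
  apply: (@reducible_perm _ ([seq ends e | e <- enum E2] ++ (u, v) :: M)).
    by rewrite -cat_rcons -[_ :: _ ++ _]/([:: (u, v)] ++ _) catA perm_cat2r perm_rcons.
  apply: IH2 => [z z2|].
    rewrite touches_cons /= => /or3P[/eqP<-|/eqP<-|]; [by left|by right|].
    by apply: MW; rewrite inE z2 orbT.
  exact: RedPar (perm_refl _) r.
Qed.

(** The solver maintains that demands vanish at nodes without arcs; for the whole digraph this makes
    the invariant vacuously true. *)
Lemma series_parallel_nodes u v w :
  series_parallel G u v -> touches w [seq ends e | e <- enum E].
Proof.
rewrite /series_parallel.
suff h W F : sp_sub G u v W F -> w \in W -> touches w [seq ends e | e <- enum F].
  by move=> /h; rewrite inE (eq_enum (in_set predT)); apply.
move=> s; elim: s => {u v W F} [e _|u x v V1 V2 E1 E2 _ IH1 _ IH2 _ dE|u v V1 V2 E1 E2 _ IH1 _ IH2 _ dE].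
- by rewrite enum_set1 /= orbF !inE ![w == _]eq_sym.
- rewrite (touches_perm _ (perm_map ends (enum_disjointU dE))) map_cat touches_cat inE.
  by case/orP=> [/IH1->|/IH2->]; rewrite ?orbT.
- rewrite (touches_perm _ (perm_map ends (enum_disjointU dE))) map_cat touches_cat inE.
  by case/orP=> [/IH1->|/IH2->]; rewrite ?orbT.
Qed.

Lemma series_parallel_reducible u v :
  series_parallel G u v -> reducible [seq ends e | e <- enum E].
Proof.
move=> s; have [uv _ _ _] := sp_sub_nodes s.
have := sp_sub_reducible_context s (M := [::]).
rewrite cats0 (eq_enum (in_set predT)); apply=> //.
by constructor.
Qed.

End SeriesParallelReducible.

(** * Multiflows under reductions *)

Section Flows.
Variables (R : realType) (V E : eqType) (k : nat).
Implicit Types (L M : seq (E * (V * V))) (b : V -> 'I_k -> R) (X : E -> 'I_k -> R).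

Definition incidence (a : V * V) (v : V) : R := (a.1 == v)%:R - (a.2 == v)%:R.

(** Labelled arcs keep parallel arcs apart, and [X] remains a function on all labels while the list
    [L] shrinks and its ends change. *)
Definition flow_on L b X : Prop :=
  (forall a i, a \in L -> 0 <= X a.1 i) /\
  (forall v i, \sum_(a <- L) X a.1 i * incidence a.2 v = b v i).

Definition update (T : Type) (X : E -> T) e x := fun e' => if e' == e then x else X e'.

Lemma flow_on_perm L M b X : perm_eq L M -> flow_on L b X -> flow_on M b X.
Proof.
move=> LM [X0 Xb]; split=> [a i aM|v i]; first by rewrite X0 ?(perm_mem LM).
by rewrite -Xb; apply: perm_big; rewrite perm_sym.
Qed.

Lemma sum_update M (g : E * (V * V) -> R) X e r i : e \notin unzip1 M ->
  \sum_(a <- M) update X e r a.1 i * g a = \sum_(a <- M) X a.1 i * g a.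
Proof.
move=> eM; apply: eq_big_seq => a aM; rewrite /update ifN //.
by apply: contra eM => /eqP <-; apply: map_f.
Qed.

Lemma flow_parallel_merge e f x y M b X :
  uniq (unzip1 [:: (e, (x, y)), (f, (x, y)) & M]) ->
  flow_on [:: (e, (x, y)), (f, (x, y)) & M] b X ->
  flow_on ((e, (x, y)) :: M) b (update X e (fun i => X e i + X f i)).
Proof.
move=> /= /andP[]; rewrite inE negb_or => /andP[ef eM] /andP[fM uM] [X0 Xb]; split=> [a i|v i].
  rewrite inE /update; case: (eqVneq a.1 e) => [_ _|ne aM].
    by rewrite /= addr_ge0 //; [apply: (X0 (e, (x, y)))|apply: (X0 (f, (x, y)))]; rewrite !inE eqxx ?orbT.
  by apply: X0; rewrite !inE; case/orP: aM => ->; rewrite ?orbT.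
rewrite -Xb !big_cons /= sum_update // /update eqxx; ring.
Qed.

Lemma flow_parallel_split e f x y M b X g :
  uniq (unzip1 [:: (e, (x, y)), (f, (x, y)) & M]) ->
  (forall i, 0 <= g i <= X e i) ->
  flow_on ((e, (x, y)) :: M) b X ->
  flow_on [:: (e, (x, y)), (f, (x, y)) & M] b
    (update (update X e g) f (fun i => X e i - g i)).
Proof.
move=> /= /andP[]; rewrite inE negb_or => /andP[ef eM] /andP[fM uM] g0 [X0 Xb]; split=> [a i|v i].
  rewrite !inE /update; case: (eqVneq a.1 f) => [_ _|nf].
    by rewrite /= subr_ge0; case/andP: (g0 i).
  case: (eqVneq a.1 e) => [_ _|ne]; first by case/andP: (g0 i).
  case/or3P => [/eqP ea|/eqP ea|aM]; [by rewrite ea eqxx in ne|by rewrite ea eqxx in nf|].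
  by apply: X0; rewrite inE aM orbT.
rewrite -Xb !big_cons /= !sum_update // /update eqxx (negPf ef) eqxx; ring.
Qed.

(* In a series merge at [w] the net outflow [b w] has to be produced by the arc
   leaving [w] or absorbed by the arc entering [w]. *)
Definition surplus b w : 'I_k -> R := fun i => if 0 <= b w i then b w i else 0.
Definition deficit b w : 'I_k -> R := fun i => surplus b w i - b w i.
Definition shift_demand b x w y : V -> 'I_k -> R := fun v i =>
  b v i - deficit b w i * incidence (x, w) v - surplus b w i * incidence (w, y) v.

Lemma surplus_ge0 b w i : 0 <= surplus b w i.
Proof. by rewrite /surplus; case: ifP. Qed.

Lemma deficit_ge0 b w i : 0 <= deficit b w i.
Proof.
rewrite /deficit /surplus; case: ifP => [_|/negbT]; first by rewrite subrr.
by rewrite -ltNge sub0r oppr_ge0 => /ltW.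
Qed.

Lemma incidence_trans x w y v :
  incidence (x, y) v = incidence (x, w) v + incidence (w, y) v.
Proof. rewrite /incidence /=; ring. Qed.

Lemma sum_untouched M X w i : ~~ touches w (unzip2 M) ->
  \sum_(a <- M) X a.1 i * incidence a.2 w = 0.
Proof.
move=> wM; apply: big1_seq => a /andP[_ aM].
have /andP[/negPf n1 /negPf n2] := touchesN_neq wM (map_f snd aM).
by rewrite /incidence n1 n2 subrr mulr0.
Qed.

Lemma flow_series_balance e f x w y M b X :
  x != w -> w != y -> ~~ touches w (unzip2 M) ->
  flow_on [:: (e, (x, w)), (f, (w, y)) & M] b X ->
  forall i, X f i - X e i = b w i.
Proof.
move=> xw wy wM [X0 Xb] i; have := Xb w i.
rewrite !big_cons /= sum_untouched // /incidence /= !eqxx (negPf xw) [y == w]eq_sym (negPf wy).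
by rewrite addr0 sub0r subr0 mulrN !mulr1 addrC.
Qed.

(** Since [X f i - X e i = b w i], removing the deficit from [X e i] leaves the smaller of [X e i]
    and [X f i], so the merged flow is nonnegative. *)
Lemma flow_series_merge e f x w y M b X :
  uniq (unzip1 [:: (e, (x, w)), (f, (w, y)) & M]) ->
  x != w -> w != y -> ~~ touches w (unzip2 M) ->
  flow_on [:: (e, (x, w)), (f, (w, y)) & M] b X ->
  flow_on ((e, (x, y)) :: M) (shift_demand b x w y)
    (update X e (fun i => X e i - deficit b w i)).
Proof.
move=> /= /andP[]; rewrite inE negb_or => /andP[ef eM] /andP[fM uM] xw wy wM fX.
have bw := flow_series_balance xw wy wM fX.
case: fX => X0 Xb; split=> [a i|v i].
  rewrite inE /update; case: (eqVneq a.1 e) => [_ _|ne aM].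
    rewrite /= /deficit /surplus; case: ifP => _; first by rewrite subrr subr0 (X0 (e, (x, w))) ?mem_head.
    rewrite sub0r opprK -bw addrC subrK (X0 (f, (w, y))) //; by rewrite !inE eqxx orbT.
  case/orP: aM => [/eqP ea|aM]; first by rewrite ea eqxx in ne.
  by apply: X0; rewrite !inE aM !orbT.
rewrite /shift_demand -Xb !big_cons /= sum_update // /update eqxx (incidence_trans x w y).
rewrite /deficit -[X f i](subrK (X e i)) bw; ring.
Qed.

Lemma flow_series_split e f x w y M b X :
  uniq (unzip1 [:: (e, (x, w)), (f, (w, y)) & M]) ->
  flow_on ((e, (x, y)) :: M) (shift_demand b x w y) X ->
  flow_on [:: (e, (x, w)), (f, (w, y)) & M] b
    (update (update X e (fun i => X e i + deficit b w i))
            f (fun i => X e i + surplus b w i)).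
Proof.
move=> /= /andP[]; rewrite inE negb_or => /andP[ef eM] /andP[fM uM] [X0 Xb]; split=> [a i|v i].
  have Xe0 : 0 <= X e i by apply: (X0 (e, (x, y))); rewrite mem_head.
  rewrite !inE /update; case: (eqVneq a.1 f) => [_ _|nf].
    by rewrite /= addr_ge0 ?surplus_ge0.
  case: (eqVneq a.1 e) => [_ _|ne]; first by rewrite /= addr_ge0 ?deficit_ge0.
  case/or3P => [/eqP ea|/eqP ea|aM]; [by rewrite ea eqxx in ne|by rewrite ea eqxx in nf|].
  by apply: X0; rewrite inE aM orbT.
have := Xb v i; rewrite !big_cons /= !sum_update // /update eqxx (negPf ef) eqxx.
rewrite /shift_demand (incidence_trans x w y) => h.
rewrite -[b v i](addrNK (deficit b w i * incidence (x, w) v)).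
rewrite -[b v i - _](addrNK (surplus b w i * incidence (w, y) v)) -h; ring.
Qed.

(** These are the additive subgroups. All reals and the integers are instances, so one argument
    covers both claims of (b), and the integrality in (a) as well. *)
Definition difference_closed (S : pred R) := S 0 /\ (forall x y, S x -> S y -> S (x - y)).

Lemma difference_closedN S x : difference_closed S -> S x -> S (- x).
Proof. by move=> [S0 SB] Sx; rewrite -sub0r SB. Qed.

Lemma difference_closedD S x y : difference_closed S -> S x -> S y -> S (x + y).
Proof. by move=> hS Sx Sy; rewrite -[y]opprK; apply: hS.2 => //; apply: difference_closedN. Qed.

Lemma difference_closed_sum S (T : Type) (s : seq T) (F : T -> R) :
  difference_closed S -> (forall i, S (F i)) -> S (\sum_(i <- s) F i).
Proof.
move=> hS SF; elim/big_ind: _ => [|x y|//]; [by case: hS|exact: difference_closedD].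
Qed.

Lemma surplus_closed S b w i : difference_closed S -> S (b w i) -> S (surplus b w i).
Proof. by move=> [S0 _] Sb; rewrite /surplus; case: ifP. Qed.

Lemma deficit_closed S b w i : difference_closed S -> S (b w i) -> S (deficit b w i).
Proof. by move=> hS Sb; apply: hS.2 => //; apply: surplus_closed. Qed.

Lemma shift_demand_closed S b x w y : difference_closed S ->
  (forall v i, S (b v i)) -> forall v i, S (shift_demand b x w y v i).
Proof.
move=> hS Sb v i.
have Sm r a u : S r -> S (r * incidence a u).
  rewrite /incidence => Sr; rewrite mulrBr; apply: hS.2; case: eqP => _ /=;
    by rewrite ?mulr1 ?mulr0 //; case: hS.
by apply: hS.2; [apply: hS.2|]; rewrite ?Sm //; apply: surplus_closed || apply: deficit_closed.
Qed.

Fixpoint fill (r : seq R) (c : R) : seq R :=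
  if r is x :: r' then
    if x <= c then x :: fill r' (c - x) else c :: fill r' 0
  else [::].

(** The greedy split takes whole entries until the budget is used up; every value is an entry of
    [r], the remaining budget or 0. This keeps it in [S], unlike a proportional split. *)
Lemma fill_spec (T : eqType) (l : seq T) (r : T -> R) c S :
  difference_closed S -> uniq l -> (forall i, 0 <= r i) -> 0 <= c ->
  exists g, [/\ [seq g i | i <- l] = fill [seq r i | i <- l] c,
                forall i, 0 <= g i <= r i,
                (forall i, S (r i)) -> S c -> forall i, S (g i) &
                \sum_(i <- l) g i = Num.min c (\sum_(i <- l) r i)].
Proof.
move=> hS ul r0 c0.
elim: l ul c c0 => [_|i l IH /= /andP[il ul]] c c0.
  exists r; split=> //; first by move=> i; rewrite r0 lexx.
  by rewrite !big_nil min_r.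
case: ifP => [ric|/negbT]; last rewrite -ltNge => cri.
  have [|g [gE g0 Sg gs]] := IH ul (c - r i); rewrite ?subr_ge0 //.
  exists (fun j => if j == i then r i else g j); split.
  - rewrite eqxx -gE; congr cons; apply/eq_in_map => j jl.
    by case: eqP => // ji; rewrite ji (negPf il) in jl.
  - by move=> j; case: eqP => [->|//]; rewrite r0 lexx.
  - by move=> Sr Sc j; case: eqP => // _; apply: Sg => //; apply: hS.2.
  - rewrite !big_cons eqxx (eq_big_seq g) => [|j jl]; last first.
      by case: eqP => // ji; rewrite ji (negPf il) in jl.
    by rewrite gs addr_minr addrC subrK.
have [//|g [gE g0 Sg gs]] := IH ul 0.
exists (fun j => if j == i then c else g j); split.
- rewrite eqxx -gE; congr cons; apply/eq_in_map => j jl.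
  by case: eqP => // ji; rewrite ji (negPf il) in jl.
- by move=> j; case: eqP => [->|//]; rewrite c0 ltW.
- by move=> Sr Sc j; case: eqP => // _; apply: Sg => //; case: hS.
- rewrite !big_cons eqxx (eq_big_seq g) => [|j jl]; last first.
    by case: eqP => // ji; rewrite ji (negPf il) in jl.
  have s0 : 0 <= \sum_(j <- l) r j by apply: sumr_ge0.
  by rewrite gs min_l // addr0 min_l // (le_trans (ltW cri)) // lerDl.
Qed.

End Flows.

(** * Rounding *)

Lemma perm_unzip2_cons2 (E T : eqType) (L : seq (E * T)) a b M :
  perm_eq (unzip2 L) [:: a, b & M] ->
  exists e f L', perm_eq L [:: (e, a), (f, b) & L'] /\ perm_eq (unzip2 L') M.
Proof.
have pick (K : seq (E * T)) c N : perm_eq (unzip2 K) (c :: N) ->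
    exists e K', perm_eq K ((e, c) :: K') /\ perm_eq (unzip2 K') N.
  move=> KN; have : c \in unzip2 K by rewrite (perm_mem KN) mem_head.
  case/mapP=> -[e c'] /= ecK cc'; subst c'.
  exists e, (rem (e, c) K); split; first exact: perm_to_rem.
  rewrite -(perm_cons c); apply: perm_trans KN; rewrite perm_sym.
  by have := perm_map snd (perm_to_rem ecK).
move=> /pick[e [K [LK /pick[f [L' [KL' L'M]]]]]].
exists e, f, L'; split=> //.
by apply: (perm_trans LK); rewrite perm_cons.
Qed.

Section Rounding.
Variables (R : realType) (V E : eqType) (k : nat).
Implicit Types (L M : seq (E * (V * V))) (b : V -> 'I_k -> R) (X : E -> 'I_k -> R).

(** The increment of the floor along a segment of length [x] that starts at [o + t]. As an increment
    it is additive over consecutive segments, as needed for parallel arcs, and it commutes with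
    adding integers, as needed for series arcs. *)
Definition rounded (o x t : R) : R :=
  (Num.floor (o + x + t))%:~R - (Num.floor (o + t))%:~R.

Lemma roundedD o x d t : d \is a Num.int -> rounded o (x + d) t = rounded o x t + d.
Proof.
move=> dZ; rewrite /rounded (_ : o + (x + d) + t = (o + x + t) + d); last ring.
by rewrite floorDrz // rmorphD /=; move: dZ; rewrite intrEfloor => /eqP ->; rewrite addrAC.
Qed.

Lemma rounded_add o x y t : rounded o (x + y) t = rounded o x t + rounded (o + x) y t.
Proof. rewrite /rounded addrA; ring. Qed.

Lemma rounded_ge0 o x t : 0 <= x -> 0 <= rounded o x t.
Proof. by move=> x0; rewrite subr_ge0 ler_int le_floor // lerD2r lerDl. Qed.

Lemma rounded_int o x t : rounded o x t \is a Num.int.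
Proof. by rewrite rpredB ?intr_int. Qed.

Lemma rounded_near o x t : x - 1 < rounded o x t < x + 1.
Proof.
rewrite /rounded; have /andP := floor_itv (o + x + t); have /andP := floor_itv (o + t).
rewrite !rmorphD /= => -[? ?] [? ?]; lra.
Qed.

Lemma rounded_itv o x t :
  (Num.floor x)%:~R <= rounded o x t <= (Num.ceil x)%:~R.
Proof.
have /andP[] := rounded_near o x t.
have /andP[x1 _] := floor_itv x; have /andP[_ x2] := ceil_itv x.
rewrite /rounded -rmorphB /= !ler_int -!ltzD1 -!(ltr_int R) !rmorphD /= => h1 h2.
by apply/andP; split; lra.
Qed.

Lemma int_difference_closed : difference_closed (fun x : R => x \is a Num.int).
Proof. by split=> [|x y]; [exact: rpred0|exact: rpredB]. Qed.

(* Rounding [x e] to [floor (o e + x e + t) - floor (o e + t)] respects series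
   composition if both parts get the same offset, and parallel composition if
   the second part is offset by the flow through the first one. *)
Lemma reducible_rounding ends : reducible ends -> forall L b X,
  perm_eq (unzip2 L) ends -> uniq (unzip1 L) ->
  (forall v i, b v i \is a Num.int) -> flow_on L b X ->
  exists o : E -> R, forall t, exists Y,
    [/\ flow_on L b Y, forall a i, a \in L -> Y a.1 i \is a Num.int &
        forall a, a \in L -> \sum_i Y a.1 i = rounded (o a.1) (\sum_i X a.1 i) t].
Proof.
elim=> {ends} [x y xy|x y K M KM _ IH|x w y K M KM xw wy wM _ IH] L b X LK uL bZ fX.
- have [a La] : exists a, L = [:: a].
    case: L {fX uL} LK => [|a [|a' L]] /perm_size //; by exists a.
  subst L; move: LK => /perm_small_eq/=/(_ isT) [ea].
  have Xa i : X a.1 i = b x i.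
    by rewrite -(fX.2 x i) big_seq1 ea /incidence /= eqxx eq_sym (negPf xy) subr0 mulr1.
  exists (fun=> 0) => t; exists X; split=> // [a' i|a']; rewrite inE => /eqP->.
    by rewrite Xa.
  (* The single arc carries the integral demand of its tail, which every offset rounds to itself. *)
  rewrite -[X in rounded _ X]add0r roundedD; last by apply: rpred_sum => i _; rewrite Xa.
  by rewrite /rounded addr0 subrr add0r.
- have [e [f [L' [LL' L'M]]]] := perm_unzip2_cons2 (perm_trans LK KM).
  have uA : uniq (unzip1 [:: (e, (x, y)), (f, (x, y)) & L']).
    by rewrite -(perm_uniq (perm_map fst LL')).
  have fA := flow_on_perm LL' fX.
  have [|||o oP] := IH _ _ _ _ _ _ (flow_parallel_merge uA fA).
  + by rewrite perm_cons.
  + by move: uA => /= /andP[]; rewrite inE negb_or => /andP[_ ->] /andP[].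
  + by [].
  have /andP[] := uA; rewrite inE negb_or => /andP[ef eL'] /andP[fL' _].
  exists (update o f (o e + \sum_i X e i)) => t.
  have [Y [fY YZ Ys]] := oP t.
  have eh := mem_head (e, (x, y)) L'.
  have Yse := Ys _ eh; rewrite /= /update eqxx big_split /= rounded_add in Yse.
  have X0 a i : a \in [:: (e, (x, y)), (f, (x, y)) & L'] -> 0 <= X a.1 i.
    by move=> ?; apply: fA.1.
  have sX0 a : a \in [:: (e, (x, y)), (f, (x, y)) & L'] -> 0 <= \sum_i X a.1 i.
    by move=> ?; apply: sumr_ge0 => i _; apply: X0.
  (* The integral flow on the merged arc is split greedily with the rounded total of [e] as budget.
     By [rounded_add] the rest is the rounded total of [f] for its shifted offset. *)
  have [||g [_ g0 gZ0 gs]] := fill_spec int_difference_closed (enum_uniq 'I_k)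
    (r := Y e) (c := rounded (o e) (\sum_i X e i) t).
  + by move=> i; apply: (fY.1 _ i eh).
  + by apply/rounded_ge0/(sX0 (e, (x, y)))/mem_head.
  have gZ := gZ0 (fun i => YZ _ i eh) (rounded_int _ _ _).
  rewrite !big_enum /= Yse min_l in gs; last first.
    by rewrite lerDl; apply/rounded_ge0/(sX0 (f, (x, y))); rewrite !inE eqxx orbT.
  exists (update (update Y e g) f (fun i => Y e i - g i)); split.
  + rewrite perm_sym in LL'; apply: (flow_on_perm LL').
    exact: flow_parallel_split.
  + move=> a i; rewrite (perm_mem LL') /update.
    case: (eqVneq a.1 f) => [_ _|nf]; first by rewrite /= rpredB ?gZ // (YZ _ i eh).
    case: (eqVneq a.1 e) => [_ _|ne]; first exact: gZ.
    rewrite !inE => /or3P[/eqP ea|/eqP ea|aL']; [by rewrite ea eqxx in ne|by rewrite ea eqxx in nf|].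
    by apply: YZ; rewrite inE aL' orbT.
  + move=> a; rewrite (perm_mem LL') /update.
    case: (eqVneq a.1 f) => [-> _|nf].
      rewrite big_split /= sumrN Yse gs; ring.
    case: (eqVneq a.1 e) => [-> _|ne]; first exact: gs.
    rewrite !inE => /or3P[/eqP ea|/eqP ea|aL']; [by rewrite ea eqxx in ne|by rewrite ea eqxx in nf|].
    by rewrite Ys ?inE ?aL' ?orbT // /update (negPf ne).
have [e [f [L' [LL' L'M]]]] := perm_unzip2_cons2 (perm_trans LK KM).
have uA : uniq (unzip1 [:: (e, (x, w)), (f, (w, y)) & L']).
  by rewrite -(perm_uniq (perm_map fst LL')).
have fA := flow_on_perm LL' fX.
have wL' : ~~ touches w (unzip2 L') by rewrite (touches_perm _ L'M).
have bal := flow_series_balance xw wy wL' fA.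
have [|||o oP] := IH _ _ _ _ _ _ (flow_series_merge uA xw wy wL' fA).
+ by rewrite perm_cons.
+ by move: uA => /= /andP[]; rewrite inE negb_or => /andP[_ ->] /andP[].
+ exact: shift_demand_closed int_difference_closed bZ.
have /andP[] := uA; rewrite inE negb_or => /andP[ef eL'] /andP[fL' _].
exists (update o f (o e)) => t.
have [Y [fY YZ Ys]] := oP t.
have eh := mem_head (e, (x, y)) L'.
have Yse := Ys _ eh; rewrite /= /update eqxx in Yse.
have dZ i : deficit b w i \is a Num.int := deficit_closed int_difference_closed (bZ w i).
have sZ i : surplus b w i \is a Num.int := surplus_closed int_difference_closed (bZ w i).
exists (update (update Y e (fun i => Y e i + deficit b w i)) f (fun i => Y e i + surplus b w i)); split.
+ rewrite perm_sym in LL'; apply: (flow_on_perm LL').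
  exact: flow_series_split.
+ move=> a i; rewrite (perm_mem LL') /update.
  case: (eqVneq a.1 f) => [_ _|nf]; first by rewrite /= rpredD ?sZ // (YZ _ i eh).
  case: (eqVneq a.1 e) => [_ _|ne]; first by rewrite /= rpredD ?dZ // (YZ _ i eh).
  rewrite !inE => /or3P[/eqP ea|/eqP ea|aL']; [by rewrite ea eqxx in ne|by rewrite ea eqxx in nf|].
  by apply: YZ; rewrite inE aL' orbT.
+ move=> a; rewrite (perm_mem LL') /update.
  case: (eqVneq a.1 f) => [-> _|nf].
    (* The totals on [f] and on the merged arc differ by the integral surplus, which passes through
       the rounding; likewise for [e] and the deficit. *)
    rewrite big_split /= Yse -roundedD; last by apply: rpred_sum => i _; apply: sZ.
    congr rounded; rewrite -big_split /=; apply: eq_bigr => i _.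
    by rewrite -[RHS](subrK (X e i)) bal /deficit; ring.
  case: (eqVneq a.1 e) => [-> _|ne].
    rewrite big_split /= Yse -roundedD; last by apply: rpred_sum => i _; apply: dZ.
    by congr rounded; rewrite -big_split /=; apply: eq_bigr => i _; rewrite subrK.
  rewrite !inE => /or3P[/eqP ea|/eqP ea|aL']; [by rewrite ea eqxx in ne|by rewrite ea eqxx in nf|].
  by rewrite Ys ?inE ?aL' ?orbT // /update (negPf ne).
Qed.

End Rounding.

(** * Averaging the rounding over the threshold *)

Section Averaging.
Variable R : realType.

(* [W] is a finite stand-in, with weights [p.1] and sample points [p.2], for
   integration over the interval from [x] to [y]. *)
Lemma threshold_average (ts : seq R) (x y : R) : x < y ->
  exists W : seq (R * R),
    [/\ forall p, p \in W -> 0 <= p.1 /\ x <= p.2 < y,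
        \sum_(p <- W) p.1 = y - x &
        forall t, t \in ts ->
          \sum_(p <- W) p.1 * (t <= p.2)%R%:R = y - Num.max x (Num.min y t)].
Proof.
elim: ts x y => [|t ts IH] x y xy.
  (* The right-hand side of the claim is the length of the part of the interval not below [t].
     Without thresholds a single sample carries the whole length. *)
  exists [:: (y - x, x)]; split=> [p||//]; rewrite ?big_seq1 // inE => /eqP-> /=.
  by rewrite lexx subr_ge0 ltW.
have [tx|xt] := leP t x.
  have [W [WI W1 Wt]] := IH _ _ xy; exists W; split=> // t'.
  rewrite inE => /orP[/eqP->|]; last exact: Wt.
  rewrite max_l ?ge_min ?tx ?orbT // -W1; apply: eq_big_seq => p /WI[_ /andP[xp _]].
  by rewrite (le_trans tx xp) mulr1.
have [yt|ty] := leP y t.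
  have [W [WI W1 Wt]] := IH _ _ xy; exists W; split=> // t'.
  rewrite inE => /orP[/eqP->|]; last exact: Wt.
  rewrite min_l // max_r ?ltW // subrr big1_seq // => p /WI[_ /andP[_ py]].
  by rewrite leNgt (lt_le_trans py yt) mulr0.
(* A threshold strictly inside cuts the interval in two; its indicator is constant on each part, and
   the other thresholds are treated on both parts by induction. *)
have [W [WI W1 Wt]] := IH _ _ xt; have [Z [ZI Z1 Zt]] := IH _ _ ty.
exists (W ++ Z); split=> [p||t'].
- rewrite mem_cat => /orP[/WI[-> /andP[-> pt]]|/ZI[-> /andP[tp ->]]].
    by rewrite (lt_trans pt ty).
  by rewrite (le_trans (ltW xt) tp).
- rewrite big_cat /= W1 Z1; ring.
rewrite big_cat inE => /orP[/eqP->|t'ts] /=.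
  rewrite big1_seq => [|p /WI[_ /andP[_ pt]]]; last by rewrite leNgt pt mulr0.
  rewrite add0r min_r ?ltW // max_r ?ltW // -Z1; apply: eq_big_seq => p /ZI[_ /andP[tp _]].
  by rewrite tp mulr1.
rewrite Wt // Zt //.
have [t't|tt'] := leP t' t.
  rewrite (min_r (le_trans t't (ltW ty))) (max_l t't); ring.
rewrite (max_r (ltW xt)) subrr add0r.
have h : t < Num.min y t' by rewrite lt_min ty.
by rewrite (max_r (ltW h)) max_r // ltW // (lt_trans xt h).
Qed.

(** For [t] in [0, 1) the floor of [z + t] is the floor of [z], plus 1 from the threshold 1 minus
    the fractional part of [z] on. The interval beyond this threshold is as long as that fractional
    part, so the mean is [z]. *)
Lemma floor_average (zs : seq R) :
  exists W : seq (R * R),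
    [/\ forall p, p \in W -> 0 <= p.1, \sum_(p <- W) p.1 = 1 &
        forall z, z \in zs -> \sum_(p <- W) p.1 * (Num.floor (z + p.2))%:~R = z].
Proof.
have [W [WI W1 Wt]] := threshold_average [seq 1 - (z - (Num.floor z)%:~R) | z <- zs] (@ltr01 R).
exists W; split=> [p /WI[]//||z zzs]; first by rewrite W1 subr0.
have := Wt _ (map_f _ zzs); have /andP[z1 z2] := floor_itv z.
rewrite rmorphD /= in z2.
rewrite min_r ?max_r; [|lra|lra] => h.
transitivity ((Num.floor z)%:~R * (\sum_(p <- W) p.1) +
  \sum_(p <- W) p.1 * (1 - (z - (Num.floor z)%:~R) <= p.2)%R%:R).
  rewrite mulr_sumr -big_split /=; apply: eq_big_seq => p /WI[_ /andP[p1 p2]].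
  rewrite [_%:~R * p.1]mulrC -mulrDr; congr (_ * _).
  case: leP => c; rewrite -?[1%:R]/(1%:~R) -?[0%:R]/(0%:~R) -?rmorphD; congr (_%:~R);
    by apply: floor_def; rewrite !rmorphD /=; apply/andP; split; lra.
by rewrite W1 h; ring.
Qed.

End Averaging.

(** * Part (a) for multiflows of a series-parallel digraph *)

Section MultiflowAsFlow.
Variables (R : realType) (V E : finType) (G : digraph V E) (k : nat).
Variable (K : 'I_k -> commodity R V).

Definition arcs := [seq (e, ends G e) | e <- enum E].

Definition net_demand (v : V) (i : 'I_k) : R :=
  if v == source (K i) then demand (K i)
  else if v == sink (K i) then - demand (K i) else 0.

Lemma unzip1_arcs : unzip1 arcs = enum E.
Proof. by rewrite /unzip1 -map_comp map_id. Qed.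

Lemma unzip2_arcs : unzip2 arcs = [seq ends G e | e <- enum E].
Proof. by rewrite /unzip2 -map_comp. Qed.

Lemma mem_arcs e : (e, ends G e) \in arcs.
Proof. by apply: map_f; rewrite mem_enum. Qed.

Lemma net_outflowE (f : E -> R) v :
  net_outflow G f v = \sum_(a <- arcs) f a.1 * incidence R a.2 v.
Proof.
rewrite /net_outflow big_map big_enum /= [X in X - _]big_mkcond [X in _ - X]big_mkcond.
rewrite -sumrB; apply: eq_bigr => e _; rewrite /incidence /=.
by case: eqP => _; case: eqP => _; rewrite ?subrr ?mulr0 ?subr0 ?mulr1 ?sub0r ?mulrN1.
Qed.

Lemma multiflowP X : multiflow G K X <-> flow_on arcs net_demand X.
Proof.
split=> [[X0 Xb]|[X0 Xb]]; split.
- by move=> a i _; apply: X0.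
- by move=> v i; have := Xb i v; rewrite net_outflowE.
- by move=> e i; apply: (X0 (e, ends G e) i (mem_arcs e)).
- by move=> i v; rewrite net_outflowE; apply: Xb.
Qed.

End MultiflowAsFlow.

Lemma multiflow_rounding (R : realType) (V E : finType) (G : digraph V E) (u0 v0 : V)
    (k : nat) (K : 'I_k -> commodity R V) (X : E -> 'I_k -> R) :
  series_parallel G u0 v0 -> (forall i, demand (K i) \is a Num.int) ->
  multiflow G K X ->
  exists (N : nat) (lambda : 'I_N -> R) (Y : 'I_N -> E -> 'I_k -> R),
    [/\ forall j, 0 <= lambda j,
        \sum_(j < N) lambda j = 1,
        forall e, total_flow X e = \sum_(j < N) lambda j * total_flow (Y j) e,
        forall j, integer_multiflow G K (Y j) &
        forall j e, (Num.floor (total_flow X e))%:~R <= total_flow (Y j) e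
                    <= (Num.ceil (total_flow X e))%:~R].
Proof.
move=> sp dZ /multiflowP fX.
have [||v i|o oP] := reducible_rounding (series_parallel_reducible sp) _ _ _ fX.
- by rewrite unzip2_arcs.
- by rewrite unzip1_arcs enum_uniq.
- by rewrite /net_demand; case: ifP => // _; case: ifP => _; rewrite ?rpredN ?rpred0.
(* The same samples average both floors in [rounded] for all arcs; the means are
   [o e + total_flow X e] and [o e], with difference [total_flow X e]. *)
have [W [W0 W1 Wz]] :=
  floor_average ([seq o e | e <- enum E] ++ [seq o e + total_flow X e | e <- enum E]).
have /fin_all_exists [Y YP] : forall j : 'I_(size W), exists Y : E -> 'I_k -> R,
    integer_multiflow G K Y /\
    forall e, total_flow Y e = rounded (o e) (total_flow X e) (nth (0, 0) W j).2.
  move=> j; have [Y [fY YZ Ys]] := oP (nth (0, 0) W j).2.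
  exists Y; split=> [|e]; last exact: (Ys _ (mem_arcs G e)).
  by split=> [|e i]; [exact/multiflowP|exact: (YZ _ i (mem_arcs G e))].
exists (size W), (fun j => (nth (0, 0) W j).1), Y; split.
- by move=> j; apply: W0; rewrite mem_nth.
- by rewrite -W1 (big_nth (0, 0)) big_mkord.
- move=> e; rewrite (eq_bigr (fun j : 'I__ =>
    (nth (0, 0) W j).1 * rounded (o e) (total_flow X e) (nth (0, 0) W j).2)); last first.
    by move=> j _; rewrite (YP j).2.
  rewrite -(big_mkord xpredT (fun j =>
    (nth (0, 0) W j).1 * rounded (o e) (total_flow X e) (nth (0, 0) W j).2)).
  rewrite -(big_nth (0, 0) xpredT (fun p => p.1 * rounded (o e) (total_flow X e) p.2)).
  rewrite (eq_bigr _ (fun p _ => mulrBr _ _ _)) sumrB !Wz ?mem_cat ?map_f ?orbT ?mem_enum //.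
  by rewrite addrC addKr.
  by rewrite (map_f (fun e => o e + total_flow X e)) ?mem_enum ?orbT.
- by move=> j; case: (YP j).
- by move=> j e; rewrite (YP j).2 rounded_itv.
Qed.

(** * Programs *)

Local Open Scope nat_scope.

(* The [i]-th entry of [library] below is called as function [i.+1]; function 0 is
   the main expression.  Several arguments are passed as one nested pair.  [Nil]
   stands for false, [Pair Nil Nil] for true. *)
Definition e_true := EPair ENil ENil.

Definition eq_body :=
  EMatch (EVar 0) ENil
 (EMatch (EVar 0) (EMatch (EVar 1) e_true ENil)
 (EMatch (EVar 3) ENil
 (ECall 1 (EPair (EVar 3) (EVar 1))))).

Definition lookup_body :=
  EMatch (EVar 0) ENil
 (EMatch (EVar 1) ENil
 (EMatch (EVar 0) ENil
 (EMatch (ECall 1 (EPair (EVar 4) (EVar 0)))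
    (ECall 2 (EPair (EVar 4) (EVar 3)))
    (EVar 3)))).

Definition add_body :=
  EMatch (EVar 0) ENil
 (EMatch (EVar 0) ENil
 (EMatch (EVar 3) ENil
 (EPair (EAdd (EVar 2) (EVar 0)) (ECall 3 (EPair (EVar 3) (EVar 1)))))).

Definition sub_body :=
  EMatch (EVar 0) ENil
 (EMatch (EVar 0) ENil
 (EMatch (EVar 3) ENil
 (EPair (ESub (EVar 2) (EVar 0)) (ECall 4 (EPair (EVar 3) (EVar 1)))))).

Definition pos_body :=
  EMatch (EVar 0) ENil
 (EPair (EIfLe EZero (EVar 0) (EVar 0) EZero) (ECall 5 (EVar 1))).

Definition sum_body :=
  EMatch (EVar 0) EZero (EAdd (EVar 0) (ECall 6 (EVar 1))).

Definition fill_body :=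
  EMatch (EVar 0) ENil
 (EMatch (EVar 0) ENil
 (EIfLe (EVar 0) (EVar 3)
   (EPair (EVar 0) (ECall 7 (EPair (EVar 1) (ESub (EVar 3) (EVar 0)))))
   (EPair (EVar 3) (ECall 7 (EPair (EVar 1) EZero))))).

Definition touch_body :=
  EMatch (EVar 0) ENil
 (EMatch (EVar 1) ENil
 (EMatch (EVar 0) ENil
 (EMatch (EVar 1) ENil
 (EMatch (EVar 1) ENil
 (EMatch (ECall 1 (EPair (EVar 2) (EVar 8)))
   (EMatch (ECall 1 (EPair (EVar 0) (EVar 8)))
     (ECall 8 (EPair (EVar 8) (EVar 7)))
     e_true)
   e_true))))).

(** Restores a partly scanned list: the reversed scanned arcs are put back in front of the
    others. *)
Definition catrev_body :=
  EMatch (EVar 0) ENil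
 (EMatch (EVar 0) (EVar 1)
 (ECall 9 (EPair (EVar 1) (EPair (EVar 0) (EVar 3))))).

(* The answer is [Nil] or consists of a flag (true for a series pair), the two arcs
   and the list of all other arcs. *)
Definition find_partner_body :=
  EMatch (EVar 0) ENil
 (EMatch (EVar 1) ENil
 (EMatch (EVar 1) ENil
 (EMatch (EVar 4) ENil (EMatch (EVar 1) ENil (EMatch (EVar 1) ENil
 (EMatch (EVar 6) ENil (EMatch (EVar 1) ENil (EMatch (EVar 1) ENil
 (ELet (ECall 9 (EPair (EVar 14) (EVar 13)))
 (EMatch (EMatch (ECall 1 (EPair (EVar 9) (EVar 3))) ENil
            (ECall 1 (EPair (EVar 9) (EVar 3))))
   (EMatch (EMatch (ECall 1 (EPair (EVar 7) (EVar 3))) ENil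
             (EMatch (ECall 8 (EPair (EVar 9) (EVar 2))) e_true ENil))
     (ECall 10 (EPair (EVar 17) (EPair (EPair (EVar 13) (EVar 15)) (EVar 14))))
     (EPair e_true (EPair (EVar 19) (EPair (EVar 15) (EVar 2)))))
   (EPair ENil (EPair (EVar 19) (EPair (EVar 15) (EVar 2)))))))))))))).

Definition find_pair_body :=
  EMatch (EVar 0) ENil
 (EMatch (EVar 1) ENil
 (ELet (ECall 10 (EPair (EVar 0) (EPair ENil (ECall 9 (EPair (EVar 2) (EVar 1))))))
 (EMatch (EVar 0)
   (ECall 11 (EPair (EPair (EVar 1) (EVar 3)) (EVar 2)))
   (EVar 2)))).

(* The demands at the tail are nonnegative iff their positive parts do not have a
   larger sum. *)
Definition solve_arc_body :=
  EMatch (EVar 1) ENil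
 (EMatch (EVar 0) ENil (EMatch (EVar 1) ENil (EMatch (EVar 1) ENil
 (ELet (ECall 2 (EPair (EVar 2) (EVar 10)))
 (ELet (ECall 6 (EVar 0))
 (EIfLe (ECall 6 (ECall 5 (EVar 1))) (EVar 0)
   (EIfLe (EVar 0) (EVar 3) (EPair (EPair (EVar 6) (EVar 1)) ENil) ENil)
   ENil)))))).

(** An open expression spliced into [solve_body]: its large indices refer to the components of the
    two arcs and to the remaining arcs, unpacked by the matches there. *)
Definition solve_parallel_body :=
  ELet (ECall 12 (EPair (EPair (EPair (EVar 10) (EPair (EVar 8) (EPair (EVar 6)
                            (EAdd (EVar 7) (EVar 1)))))
                          (EVar 13)) (EVar 20)))
 (EMatch (EVar 0) ENil
 (ELet (ECall 2 (EPair (EVar 13) (EVar 2)))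
 (ELet (ECall 7 (EPair (EVar 0) (EVar 11)))
 (EPair (EPair (EVar 15) (EVar 0))
 (EPair (EPair (EVar 9) (ECall 4 (EPair (EVar 1) (EVar 0)))) (EVar 4)))))).

(** Also an open expression. The flag of a series pair is itself a pair whose match binds two more
    variables, so the indices start two higher than in the parallel case. The new table gets three
    entries: tail, head and a zero row for the contracted node, obtained by subtracting its row from
    itself. *)
Definition solve_series_body :=
  ELet (ECall 2 (EPair (EVar 8) (EVar 22)))
 (ELet (ECall 5 (EVar 0))
 (ELet (ECall 4 (EPair (EVar 0) (EVar 1)))
 (ELet (ESub (EVar 12) (ECall 6 (EVar 0)))
 (ELet (ESub (EVar 7) (ECall 6 (EVar 2)))
 (ELet (EIfLe (EVar 0) (EVar 1) (EVar 0) (EVar 1))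
 (EIfLe EZero (EVar 0)
   (ELet (ECall 12
      (EPair (EPair (EPair (EVar 18) (EPair (EVar 16) (EPair (EVar 8) (EVar 0))))
                    (EVar 21))
        (EPair (EPair (EVar 16) (ECall 4 (EPair (ECall 2 (EPair (EVar 16) (EVar 28))) (EVar 3))))
        (EPair (EPair (EVar 8) (ECall 3 (EPair (ECall 2 (EPair (EVar 8) (EVar 28))) (EVar 4))))
        (EPair (EPair (EVar 14) (ECall 4 (EPair (EVar 5) (EVar 5))))
               (EVar 28))))))
   (EMatch (EVar 0) ENil
   (ELet (ECall 2 (EPair (EVar 21) (EVar 2)))
   (EPair (EPair (EVar 22) (ECall 3 (EPair (EVar 0) (EVar 7))))
   (EPair (EPair (EVar 16) (ECall 3 (EPair (EVar 0) (EVar 8))))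
          (EVar 3))))))
   ENil)))))).

(* The argument consists of the arcs and of a table of the demands at each node.
   The answer is [Nil] if there is no feasible multiflow, and otherwise a table of
   the flows on each arc.  In both tables an entry shadows the later ones with the
   same key. *)
Definition solve_body :=
  EMatch (EVar 0) ENil
 (ELet (ECall 11 (EPair ENil (EVar 0)))
 (EMatch (EVar 0) solve_arc_body
 (EMatch (EVar 1) ENil (EMatch (EVar 1) ENil
 (EMatch (EVar 2) ENil (EMatch (EVar 1) ENil (EMatch (EVar 1) ENil
 (EMatch (EVar 6) ENil (EMatch (EVar 1) ENil (EMatch (EVar 1) ENil
 (EMatch (EVar 16) solve_parallel_body solve_series_body))))))))))).

Definition total_body :=
  EMatch (EVar 0) EZero
 (EMatch (EVar 0) EZero
 (EMatch (EVar 1) EZero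
 (EAdd (EVar 1) (ECall 13 (EVar 5))))).

Definition label_body :=
  EMatch (EVar 0) ENil
 (EMatch (EVar 1) ENil
 (EPair (EPair (EVar 2) (EVar 0))
        (ECall 14 (EPair (EPair ENil (EVar 2)) (EVar 1))))).

Definition demand_row_body :=
  EMatch (EVar 0) ENil
 (EMatch (EVar 1) ENil
 (EMatch (EVar 0) ENil
 (EMatch (EVar 1) ENil
 (EPair (EMatch (ECall 1 (EPair (EVar 6) (EVar 2)))
          (EMatch (ECall 1 (EPair (EVar 6) (EVar 0)))
            EZero (ESub EZero (EVar 3)))
          (EVar 3))
        (ECall 15 (EPair (EVar 6) (EVar 5))))))).

(** The tail of a unary number is its predecessor, so one recursion on the number of nodes runs
    through all nodes, from the last one down. *)
Definition demand_table_body :=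
  EMatch (EVar 0) ENil
 (EMatch (EVar 0) ENil
 (EPair (EPair (EVar 1) (ECall 15 (EPair (EVar 1) (EVar 3))))
        (ECall 16 (EPair (EVar 1) (EVar 3))))).

Definition rows_body :=
  EMatch (EVar 0) ENil
 (EMatch (EVar 0) ENil
 (EMatch (EVar 0) ENil
 (EPair (ECall 2 (EPair (EVar 0) (EVar 5))) (ECall 17 (EPair (EVar 3) (EVar 5)))))).

(** Inside [e], index 0 is the list of commodities, 2 the arcs, 4 and 6 the end and start node, 8
    the number of nodes and 10 the whole instance. *)
Definition open_instance e :=
  EMatch (EVar 0) ENil
 (EMatch (EVar 1) ENil
 (EMatch (EVar 1) ENil
 (EMatch (EVar 1) ENil
 (EMatch (EVar 1) ENil e)))).

Definition start_body := open_instance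
 (ELet (ECall 14 (EPair ENil (EVar 2)))
 (EPair (EVar 0) (ECall 12 (EPair (EVar 0) (ECall 16 (EPair (EVar 9) (EVar 1))))))).

(** Each commodity becomes an arc into node 0, from a node of its own numbered by a counter. *)
Definition gadget_body :=
  EMatch (EVar 0) ENil
 (EMatch (EVar 1) ENil
 (EMatch (EVar 2) ENil
 (EPair (EPair (EVar 2) (EPair ENil (EVar 3)))
        (ECall 19 (EPair (EVar 1) (EPair (EPair ENil (EVar 2)) (EVar 3))))))).

Definition demands_body :=
  EMatch (EVar 0) ENil
 (EMatch (EVar 0) ENil
 (EMatch (EVar 1) ENil
 (EPair (EVar 1) (ECall 20 (EVar 5))))).

Definition reduction_main := open_instance
 (EPair
   (EPair (EMatch (ECall 18 (EVar 10)) EZero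
           (EMatch (EVar 1) EZero (ESub EZero (ECall 13 (EVar 4)))))
          (ECall 20 (EVar 0)))
   (ECall 19 (EPair (EVar 0) (EPair e_true (ECall 13 (EVar 2)))))).

Definition recovery_main :=
  EMatch (EVar 0) ENil
 (EMatch (ECall 18 (EVar 0)) ENil
 (ECall 17 (EPair (EVar 0) (EVar 1)))).

Definition library : program :=
  [:: eq_body; lookup_body; add_body; sub_body; pos_body; sum_body; fill_body;
      touch_body; catrev_body; find_partner_body; find_pair_body; solve_body;
      total_body; label_body; demand_row_body; demand_table_body; rows_body;
      start_body; gadget_body; demands_body].

(** * Derived evaluation rules with time bounds *)

Section Evaluation.
Variables (R : realType) (main : expr).
Let p : program := main :: library.

Definition evaluates env e (a : value R) T := exists2 t, eval p env e a t & (t <= T)%N.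

Lemma ev_weaken env e a T T' : evaluates env e a T -> (T <= T')%N -> evaluates env e a T'.
Proof. by move=> [t et tT] TT'; exists t => //; apply: leq_trans TT'. Qed.

Lemma ev_var env i a : onth env i = Some a -> evaluates env (EVar i) a 1.
Proof. by move=> ia; exists 1; [constructor|]. Qed.

Lemma ev_nil env : evaluates env ENil Nil 1.
Proof. by exists 1; [constructor|]. Qed.

Lemma ev_zero env : evaluates env EZero (Scalar 0%R) 1.
Proof. by exists 1; [constructor|]. Qed.

Lemma ev_pair env e1 e2 a1 a2 T1 T2 : evaluates env e1 a1 T1 -> evaluates env e2 a2 T2 ->
  evaluates env (EPair e1 e2) (Pair a1 a2) (T1 + T2).+1.
Proof. by move=> [t1 h1 l1] [t2 h2 l2]; exists (t1 + t2).+1; [constructor|lia]. Qed.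

Lemma ev_add env e1 e2 x1 x2 T1 T2 : evaluates env e1 (Scalar x1) T1 ->
  evaluates env e2 (Scalar x2) T2 -> evaluates env (EAdd e1 e2) (Scalar (x1 + x2)%R) (T1 + T2).+1.
Proof. by move=> [t1 h1 l1] [t2 h2 l2]; exists (t1 + t2).+1; [constructor|lia]. Qed.

Lemma ev_sub env e1 e2 x1 x2 T1 T2 : evaluates env e1 (Scalar x1) T1 ->
  evaluates env e2 (Scalar x2) T2 -> evaluates env (ESub e1 e2) (Scalar (x1 - x2)%R) (T1 + T2).+1.
Proof. by move=> [t1 h1 l1] [t2 h2 l2]; exists (t1 + t2).+1; [constructor|lia]. Qed.

Lemma ev_let env e1 e2 a1 a2 T1 T2 : evaluates env e1 a1 T1 -> evaluates (a1 :: env) e2 a2 T2 ->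
  evaluates env (ELet e1 e2) a2 (T1 + T2).+1.
Proof.
by move=> [t1 h1 l1] [t2 h2 l2]; exists (t1 + t2).+1; [apply: EvLet h1 h2|lia].
Qed.

Lemma ev_match_nil env e0 e1 e2 a T0 T1 : evaluates env e0 Nil T0 -> evaluates env e1 a T1 ->
  evaluates env (EMatch e0 e1 e2) a (T0 + T1).+1.
Proof.
by move=> [t1 h1 l1] [t2 h2 l2]; exists (t1 + t2).+1; [apply: EvMatchNil|lia].
Qed.

Lemma ev_match_pair env e0 e1 e2 a1 a2 a T0 T2 : evaluates env e0 (Pair a1 a2) T0 ->
  evaluates [:: a1, a2 & env] e2 a T2 -> evaluates env (EMatch e0 e1 e2) a (T0 + T2).+1.
Proof.
by move=> [t1 h1 l1] [t2 h2 l2]; exists (t1 + t2).+1; [apply: EvMatchPair h1 h2|lia].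
Qed.

Lemma ev_ifle env e1 e2 e3 e4 x1 x2 a T1 T2 T :
  evaluates env e1 (Scalar x1) T1 -> evaluates env e2 (Scalar x2) T2 ->
  evaluates env (if (x1 <= x2)%R then e3 else e4) a T ->
  evaluates env (EIfLe e1 e2 e3 e4) a (T1 + T2 + T).+1.
Proof.
move=> [t1 h1 l1] [t2 h2 l2] [t h l]; exists (t1 + t2 + t).+1; last lia.
exact: EvIfLe h1 h2 h.
Qed.

(** Specifications are stated for argument values, so that an induction hypothesis applies to a
    recursive call whatever expression computes its argument. *)
Definition calls f a b T := exists2 body, onth p f = Some body & evaluates [:: a] body b T.

Lemma ev_call env f e a1 a T1 T : evaluates env e a1 T1 -> calls f a1 a T ->
  evaluates env (ECall f e) a (T1 + T).+1.
Proof.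
move=> [t1 h1 l1] [body pf [t h l]]; exists (t1 + t).+1; last lia.
exact: EvCall h1 pf h.
Qed.

Lemma call_weaken f a b T T' : calls f a b T -> (T <= T')%N -> calls f a b T'.
Proof. by move=> [body pf h] TT'; exists body => //; apply: ev_weaken h TT'. Qed.

Lemma callI f body a b T T' : onth p f = Some body -> evaluates [:: a] body b T ->
  (T <= T')%N -> calls f a b T'.
Proof. by move=> pf h TT'; exists body => //; apply: ev_weaken h TT'. Qed.

Definition enc_bool (b : bool) : value R := if b then Pair Nil Nil else Nil.

(** Both branches have to evaluate and both are charged, which spares a case distinction with
    separate time bounds. *)
Lemma ev_if env e0 e1 e2 b a1 a2 T0 T1 T2 : evaluates env e0 (enc_bool b) T0 ->
  evaluates [:: Nil, Nil & env] e2 a2 T2 -> evaluates env e1 a1 T1 ->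
  evaluates env (EMatch e0 e1 e2) (if b then a2 else a1) (T0 + T1 + T2).+1.
Proof.
case: b => h0 h2 h1.
  by eapply ev_weaken; [eapply ev_match_pair; [exact: h0|exact: h2]|lia].
by eapply ev_weaken; [eapply ev_match_nil; [exact: h0|exact: h1]|lia].
Qed.

Lemma ev_and env e1 e2 b1 b2 T1 T2 : evaluates env e1 (enc_bool b1) T1 ->
  evaluates [:: Nil, Nil & env] e2 (enc_bool b2) T2 ->
  evaluates env (EMatch e1 ENil e2) (enc_bool (b1 && b2)) (T1 + T2).+2.
Proof.
move=> h1 h2; have := ev_if h1 h2 (ev_nil env); case: b1 {h1} => h.
  by apply: ev_weaken h _; lia.
by apply: ev_weaken h _; lia.
Qed.

Lemma ev_not env e b T : evaluates env e (enc_bool b) T ->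
  evaluates env (EMatch e e_true ENil) (enc_bool (~~ b)) (T + 5).
Proof.
move=> h; have ht : evaluates env e_true (enc_bool true) 3 := ev_pair (ev_nil _) (ev_nil _).
have := ev_if h (ev_nil _) ht; case: b {h} => h; apply: ev_weaken h _; lia.
Qed.

End Evaluation.

Ltac ev_value := eapply ev_var; reflexivity.
Ltac ev_step := first
  [ ev_value | eapply ev_nil | eapply ev_zero | eapply ev_pair | eapply ev_add
  | eapply ev_sub | eapply ev_let | eapply ev_ifle
  | eapply ev_match_pair; [ev_value|] | eapply ev_match_nil; [ev_value|] | eapply ev_call ].
Ltac ev_steps := repeat ev_step.
Ltac ev_fun := eapply callI; [reflexivity| |].

(** * The subroutines on numbers, rows and arc lists *)

Section Programs.
Variables (R : realType) (main : expr).
Local Notation ev := (evaluates main).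
Local Notation call := (calls main).

Lemma call_eq (m n : nat) :
  call 1 (Pair (enc_nat R m) (enc_nat R n)) (enc_bool R (m == n)) (14 * m.+1).
Proof.
elim: m n => [|m IH] [|n]; ev_fun.
- ev_steps.
- by [].
- ev_steps.
- by [].
- ev_steps.
- by lia.
- ev_steps. apply: IH.
- lia.
Qed.

Definition enc_reals (s : seq R) : value R := enc_seq [seq Scalar x | x <- s].

Fixpoint alookup (key : nat) (al : seq (nat * seq R)) : seq R :=
  if al is a :: al' then if key == a.1 then a.2 else alookup key al' else [::].

Definition enc_assoc (al : seq (nat * seq R)) : value R :=
  enc_seq [seq Pair (enc_nat R a.1) (enc_reals a.2) | a <- al].

Lemma call_lookup key al :
  call 2 (Pair (enc_nat R key) (enc_assoc al)) (enc_reals (alookup key al))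
    ((size al).+1 * (14 * key + 40)).
Proof.
elim: al => [|[k' r] al IH]; first by ev_fun; [ev_steps|lia].
have := call_eq key k'; rewrite /=; case: eqP => _ h; ev_fun.
- do 3!(eapply ev_match_pair; [ev_value|]).
  eapply ev_match_pair; [ev_steps; exact: h|ev_steps].
- by rewrite /=; lia.
- do 3!(eapply ev_match_pair; [ev_value|]).
  eapply ev_match_nil; [ev_steps; exact: h|ev_steps; exact: IH].
- by rewrite /=; lia.
Qed.

Lemma call_add (T : Type) (l : seq T) (f g : T -> R) :
  call 3 (Pair (enc_reals [seq f i | i <- l]) (enc_reals [seq g i | i <- l]))
    (enc_reals [seq (f i + g i)%R | i <- l]) (20 * (size l).+1).
Proof.
elim: l => [|x l IH]; ev_fun; [by ev_steps|by []| |].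
  by ev_steps; exact: IH.
by rewrite /=; lia.
Qed.

Lemma call_sub (T : Type) (l : seq T) (f g : T -> R) :
  call 4 (Pair (enc_reals [seq f i | i <- l]) (enc_reals [seq g i | i <- l]))
    (enc_reals [seq (f i - g i)%R | i <- l]) (20 * (size l).+1).
Proof.
elim: l => [|x l IH]; ev_fun; [by ev_steps|by []| |].
  by ev_steps; exact: IH.
by rewrite /=; lia.
Qed.

Lemma call_pos (T : Type) (l : seq T) (f : T -> R) :
  call 5 (enc_reals [seq f i | i <- l])
    (enc_reals [seq (if 0 <= f i then f i else 0)%R | i <- l]) (20 * (size l).+1).
Proof.
elim: l => [|x l IH]; first by ev_fun; [ev_steps|].
rewrite /=; case: ifP => fx; ev_fun.
- eapply ev_match_pair; [ev_value|].
  eapply ev_pair; last by ev_steps; exact: IH.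
  by ev_steps; rewrite fx; ev_steps.
- by rewrite /=; lia.
- eapply ev_match_pair; [ev_value|].
  eapply ev_pair; last by ev_steps; exact: IH.
  by ev_steps; rewrite fx; ev_steps.
- by rewrite /=; lia.
Qed.

Lemma call_sum (T : Type) (l : seq T) (f : T -> R) :
  call 6 (enc_reals [seq f i | i <- l]) (Scalar (\sum_(i <- l) f i)%R) (20 * (size l).+1).
Proof.
elim: l => [|x l IH]; ev_fun; [by rewrite big_nil; ev_steps|by []| |].
  by rewrite big_cons; ev_steps; exact: IH.
by rewrite /=; lia.
Qed.

Lemma call_fill (r : seq R) c :
  call 7 (Pair (enc_reals r) (Scalar c)) (enc_reals (fill r c)) (20 * (size r).+1).
Proof.
elim: r c => [|x r IH] c; first by ev_fun; [ev_steps|].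
rewrite /=; case: ifP => xc; ev_fun.
- do 2!(eapply ev_match_pair; [ev_value|]).
  by eapply ev_ifle; [ev_value|ev_value|rewrite xc; ev_steps; exact: IH].
- by rewrite /=; lia.
- do 2!(eapply ev_match_pair; [ev_value|]).
  by eapply ev_ifle; [ev_value|ev_value|rewrite xc; ev_steps; exact: IH].
- by rewrite /=; lia.
Qed.

Section Arcs.
Variables (n m : nat) (N : nat).
Hypothesis nN : n <= N.
Implicit Types (c : 'I_m -> R) (a A B : 'I_m * ('I_n * 'I_n)).
Implicit Types L M : seq ('I_m * ('I_n * 'I_n)).

Definition enc_arc c a : value R :=
  Pair (enc_nat R a.1) (Pair (enc_nat R a.2.1) (Pair (enc_nat R a.2.2) (Scalar (c a.1)))).

Definition enc_arc_seq c L : value R := enc_seq [seq enc_arc c a | a <- L].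

Lemma call_eq_node (x y : 'I_n) :
  call 1 (Pair (enc_nat R x) (enc_nat R y)) (enc_bool R (x == y)) (14 * N).
Proof.
apply: call_weaken (call_eq x y) _; have := ltn_ord x; lia.
Qed.

Definition touch_time (l : nat) := l.+1 * (28 * N + 60).

Lemma call_touch (w : 'I_n) c L :
  call 8 (Pair (enc_nat R w) (enc_arc_seq c L)) (enc_bool R (touches w (unzip2 L)))
    (touch_time (size L)).
Proof.
elim: L => [|[e [x y]] L IH]; first by ev_fun; [ev_steps|rewrite /touch_time; lia].
rewrite touches_cons /=; have := call_eq_node x w; have := call_eq_node y w.
case: eqVneq => _ hy; case: eqVneq => _ hx; rewrite ?orbT /=; ev_fun.
- do 5!(eapply ev_match_pair; [ev_value|]).
  by eapply ev_match_pair; [ev_steps; exact: hx|ev_steps].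
- rewrite /touch_time /=; lia.
- do 5!(eapply ev_match_pair; [ev_value|]).
  eapply ev_match_nil; [ev_steps; exact: hx|].
  by eapply ev_match_pair; [ev_steps; exact: hy|ev_steps].
- rewrite /touch_time /=; lia.
- do 5!(eapply ev_match_pair; [ev_value|]).
  by eapply ev_match_pair; [ev_steps; exact: hx|ev_steps].
- rewrite /touch_time /=; lia.
- do 5!(eapply ev_match_pair; [ev_value|]).
  eapply ev_match_nil; [ev_steps; exact: hx|].
  by eapply ev_match_nil; [ev_steps; exact: hy|ev_steps; exact: IH].
- rewrite /touch_time /=; lia.
Qed.

Lemma call_catrev c L M :
  call 9 (Pair (enc_arc_seq c L) (enc_arc_seq c M)) (enc_arc_seq c (catrev L M))
    (16 * (size L).+1).
Proof.
elim: L M => [|a L IH] M; ev_fun; [by ev_steps|by []| |].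
  ev_steps; exact: (IH (a :: M)).
by rewrite /=; lia.
Qed.

Definition series_pair A B M := (A.2.2 == B.2.1) && ~~ touches A.2.2 (unzip2 M).

(** [L] collects the rejected candidates in reverse, so [catrev L M'] lists all arcs other than [A]
    and [B]: the arcs that must avoid the middle node. *)
Fixpoint find_partner A L M :=
  if M is B :: M' then
    if A.2 == B.2 then Some (false, A, B, catrev L M')
    else if series_pair A B (catrev L M') then Some (true, A, B, catrev L M')
    else find_partner A (B :: L) M'
  else None.

Fixpoint find_pair L M :=
  if M is A :: M' then
    if find_partner A [::] (catrev L M') is Some r then Some r
    else find_pair (A :: L) M'
  else None.

Definition enc_found c (r : option (bool * _ * _ * seq _)) : value R :=
  if r is Some (s, A, B, M) then
    Pair (enc_bool R s) (Pair (enc_arc c A) (Pair (enc_arc c B) (enc_arc_seq c M)))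
  else Nil.

Definition partner_time l := 56 * N + touch_time l + 16 * l.+1 + 200.

Lemma call_find_partner c A L M q : size L + size M <= q ->
  call 10 (Pair (enc_arc c A) (Pair (enc_arc_seq c L) (enc_arc_seq c M)))
    (enc_found c (find_partner A L M)) ((size M).+1 * partner_time q).
Proof.
elim: M L => [|B M IH] L lq; first by ev_fun; [ev_steps|rewrite /partner_time; lia].
have h1 : call 9 (Pair (enc_arc_seq c L) (enc_arc_seq c M))
    (enc_arc_seq c (catrev L M)) (16 * q.+1).
  by apply: call_weaken (call_catrev c L M) _; move: lq => /=; lia.
have hw : call 8 (Pair (enc_nat R A.2.2) (enc_arc_seq c (catrev L M)))
    (enc_bool R (touches A.2.2 (unzip2 (catrev L M)))) (touch_time q).
  apply: call_weaken (call_touch _ _ _) _.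
  rewrite /touch_time catrevE size_cat size_rev; move: lq => /= lq; apply: leq_mul => //; lia.
have := call_eq_node A.2.1 B.2.1; have := call_eq_node A.2.2 B.2.2.
have := call_eq_node A.2.2 B.2.1.
(* Equality of arcs is unfolded into the two node tests that the program performs. *)
have -> : find_partner A L (B :: M) =
    if (A.2.1 == B.2.1) && (A.2.2 == B.2.2) then Some (false, A, B, catrev L M)
    else if series_pair A B (catrev L M) then Some (true, A, B, catrev L M)
    else find_partner A (B :: L) M.
  by rewrite /=; case: A.2 => ? ?; case: B.2.
rewrite /series_pair; move: hw.
have {IH} := IH (B :: L); rewrite addSnnS => /(_ lq) {lq}.
case: A h1 => ia [xa ya] h1; case: B => ib [xb yb] /=.
set t := touches _ _; move=> IH ht hs hy hx.
ev_fun.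
- do 9!(eapply ev_match_pair; [ev_value|]).
  eapply ev_let; [ev_steps; exact: h1|].
  rewrite fun_if; eapply ev_if.
  + by eapply ev_and; ev_steps; [exact: hx|exact: hy].
  + by ev_steps.
  + rewrite fun_if; eapply ev_if; last by ev_steps; exact: IH.
    * eapply ev_and; first by ev_steps; exact: hs.
      by eapply ev_not; ev_steps; exact: ht.
    * by ev_steps.
- rewrite /partner_time; lia.
Qed.

Definition pair_time l := l.+1 * partner_time l + 16 * l.+1 + 100.

Lemma call_find_pair c L M q : size L + size M <= q ->
  call 11 (Pair (enc_arc_seq c L) (enc_arc_seq c M))
    (enc_found c (find_pair L M)) ((size M).+1 * pair_time q).
Proof.
elim: M L => [|A M IH] L lq; first by ev_fun; [ev_steps|rewrite /pair_time; lia].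
have h1 : call 9 (Pair (enc_arc_seq c L) (enc_arc_seq c M))
    (enc_arc_seq c (catrev L M)) (16 * q.+1).
  by apply: call_weaken (call_catrev c L M) _; move: lq => /=; lia.
have h2 : call 10 (Pair (enc_arc c A) (Pair (enc_arc_seq c [::]) (enc_arc_seq c (catrev L M))))
    (enc_found c (find_partner A [::] (catrev L M))) (q.+1 * partner_time q).
  have sq : size (catrev L M) < q by rewrite catrevE size_cat size_rev; move: lq => /=; lia.
  apply: call_weaken (@call_find_partner c A [::] _ q _) _; first by rewrite add0n ltnW.
  exact: leq_mul (leqW sq) (leqnn _).
have {IH} := IH (A :: L); rewrite addSnnS => /(_ lq) IH.
rewrite /=; case: (find_partner A [::] (catrev L M)) h2 => [[[[s A'] B'] M']|] h2; ev_fun.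
- do 2!(eapply ev_match_pair; [ev_value|]).
  eapply ev_let; first by ev_steps; [exact: h1|exact: h2].
  by ev_steps.
- rewrite /pair_time; lia.
- do 2!(eapply ev_match_pair; [ev_value|]).
  eapply ev_let; first by ev_steps; [exact: h1|exact: h2].
  by ev_steps; exact: IH.
- rewrite /pair_time; lia.
Qed.

End Arcs.

End Programs.

(** * Soundness and completeness of the search for a reduction *)

Section Found.
Variables (n m : nat).
Implicit Types (A B : 'I_m * ('I_n * 'I_n)) (L M : seq ('I_m * ('I_n * 'I_n))).

Definition reduction_found (s : bool) A B M :=
  if s then A.2.2 = B.2.1 /\ ~~ touches A.2.2 (unzip2 M) else A.2 = B.2.

Lemma find_partner_sound A L M s A' B M' :
  find_partner A L M = Some (s, A', B, M') ->
  [/\ A' = A, perm_eq (catrev L M) (B :: M') & reduction_found s A B M'].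
Proof.
elim: M L => [|C M IH] L //=.
have LM : perm_eq (catrev L (C :: M)) (C :: catrev L M).
  by rewrite !catrevE -cat_rcons -cat_cons perm_cat2r perm_rcons.
case: eqP => [AC [<- <- <- <-]|_]; first by [].
case: ifP => [/andP[/eqP AC t] [<- <- <- <-]|_ /IH]; last exact.
by split.
Qed.

Lemma find_pair_sound L M s A B M' : find_pair L M = Some (s, A, B, M') ->
  perm_eq (catrev L M) [:: A, B & M'] /\ reduction_found s A B M'.
Proof.
elim: M L => [|C M IH] L //=.
have LM : perm_eq (catrev L (C :: M)) (C :: catrev L M).
  by rewrite !catrevE -cat_rcons -cat_cons perm_cat2r perm_rcons.
case E: find_partner => [[[[s' A'] B'] M'']|]; last by move/IH.
move: E => /find_partner_sound[-> p r] [<- <- <- <-]; split=> //.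
by apply: (perm_trans LM); rewrite perm_cons.
Qed.

Lemma find_partner_complete A L M : find_partner A L M = None ->
  forall B M', B \in M -> perm_eq (catrev L M) (B :: M') ->
  A.2 != B.2 /\ ~~ ((A.2.2 == B.2.1) && ~~ touches A.2.2 (unzip2 M')).
Proof.
elim: M L => [|C M IH] L //=.
have LM : perm_eq (catrev L (C :: M)) (C :: catrev L M).
  by rewrite !catrevE -cat_rcons -cat_cons perm_cat2r perm_rcons.
case: ifP => // AC; case: ifP => // sAC fN B M'.
rewrite inE => /orP[/eqP->|BM]; last exact: (IH (C :: L) fN).
rewrite (permPl LM) perm_cons => MM'; split; first by rewrite AC.
by rewrite -(touches_perm _ (perm_map snd MM')) -/(series_pair A C _) sAC.
Qed.

Lemma find_pair_complete L M : find_pair L M = None ->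
  forall A B M', A \in M -> perm_eq (catrev L M) [:: A, B & M'] ->
  A.2 != B.2 /\ ~~ ((A.2.2 == B.2.1) && ~~ touches A.2.2 (unzip2 M')).
Proof.
elim: M L => [|C M IH] L //=.
have LM : perm_eq (catrev L (C :: M)) (C :: catrev L M).
  by rewrite !catrevE -cat_rcons -cat_cons perm_cat2r perm_rcons.
case E: find_partner => [//|] fN A B M'.
rewrite inE => /orP[/eqP->|AM]; last exact: (IH (C :: L) fN).
rewrite (permPl LM) perm_cons => MM'.
by apply: (find_partner_complete E) => //; rewrite (perm_mem MM') mem_head.
Qed.

(** A derivation for more than one arc begins with a reduction, and the exhaustive search over
    ordered pairs would have found one. *)
Lemma find_pair_none L : find_pair [::] L = None -> reducible (unzip2 L) ->
  exists2 a, L = [:: a] & a.2.1 != a.2.2.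
Proof.
move=> /find_pair_complete fN; move E: (unzip2 L) => K r.
case: r E => {K} [x y xy|x y K M KM _|x w y K M KM _ _ wM _] LK.
- case: L LK {fN} => [//|[e a] [|//]] /= [ea]; exists (e, a) => //=.
  by rewrite ea.
- move: KM; rewrite -LK => /perm_unzip2_cons2[e [f [L' [LL' _]]]].
  have [|/eqP//] := fN (e, (x, y)) _ _ _ LL'.
  by rewrite (perm_mem LL') mem_head.
- move: KM; rewrite -LK => /perm_unzip2_cons2[e [f [L' [LL' L'M]]]].
  have [|_] := fN (e, (x, w)) _ _ _ LL'; first by rewrite (perm_mem LL') mem_head.
  by rewrite /= eqxx (touches_perm _ L'M) wM.
Qed.

End Found.

(** * The recursive solver *)

Section Solve.
Variables (R : realType) (main : expr).
Local Notation ev := (evaluates main).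
Local Notation call := (calls main).
Variables (n m k N : nat).
Hypotheses (nN : n <= N) (mN : m <= N) (kN : k <= N).
Implicit Types (c : 'I_m -> R) (L M : seq ('I_m * ('I_n * 'I_n))).
Implicit Types (b : 'I_n -> 'I_k -> R) (X : 'I_m -> 'I_k -> R).

Definition row (r : 'I_k -> R) : seq R := [seq r i | i <- enum 'I_k].

Lemma eq_row r s : r =1 s -> row r = row s.
Proof. by move=> rs; apply: eq_map. Qed.

(** The demand table starts with at most [N] entries and gains three in each of at most [N] series
    steps, whence [4 * N]. *)
Definition lookup_time := (4 * N).+1 * (14 * N + 40).
Definition row_time := 20 * N.+1.
Definition level_time := N.+1 * pair_time N N + 4 * lookup_time + 12 * row_time + 500.

Lemma call_lookup_key (key : nat) al : key < N -> size al <= 4 * N ->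
  call 2 (Pair (enc_nat R key) (enc_assoc al)) (enc_reals (alookup key al)) lookup_time.
Proof.
move=> ltN sal; apply: call_weaken (call_lookup _ _ _) _.
by apply: leq_mul; move: ltN sal; clear; lia.
Qed.

Lemma row_time_le : 20 * (size (enum 'I_k)).+1 <= row_time.
Proof. by rewrite size_enum_ord /row_time; lia. Qed.

Lemma call_add_row r s : call 3 (Pair (enc_reals (row r)) (enc_reals (row s)))
  (enc_reals (row (fun i => r i + s i)%R)) row_time.
Proof. exact: call_weaken (call_add _ _ _ _) row_time_le. Qed.

Lemma call_sub_row r s : call 4 (Pair (enc_reals (row r)) (enc_reals (row s)))
  (enc_reals (row (fun i => r i - s i)%R)) row_time.
Proof. exact: call_weaken (call_sub _ _ _ _) row_time_le. Qed.

Lemma call_pos_row r : call 5 (enc_reals (row r))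
  (enc_reals (row (fun i => if 0 <= r i then r i else 0)%R)) row_time.
Proof. exact: call_weaken (call_pos _ _ _) row_time_le. Qed.

Lemma call_sum_row r : call 6 (enc_reals (row r)) (Scalar (\sum_i r i)%R) row_time.
Proof.
rewrite (_ : (\sum_i r i = \sum_(i <- enum 'I_k) r i)%R); last by rewrite big_enum.
exact: call_weaken (call_sum _ _ _) row_time_le.
Qed.

Lemma call_fill_row r (x : R) : call 7 (Pair (enc_reals (row r)) (Scalar x))
  (enc_reals (fill (row r) x)) row_time.
Proof. by apply: call_weaken (call_fill _ _ _) _; rewrite size_map row_time_le. Qed.

Definition within L (c : 'I_m -> R) X := forall a, a \in L -> (\sum_i X a.1 i <= c a.1)%R.

(** A nonempty table cannot be encoded as [Nil], so success and failure are told apart. Membership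
    in [S] is conditional because the demands of an instance are arbitrary reals even when [S]
    consists of the integers. *)
Definition solution (S : pred R) L c b out :=
  (out = Nil /\ forall X, flow_on L b X -> ~ within L c X) \/
  exists res X, [/\ out = enc_assoc res, 0 < size res <= 2 * size L,
    flow_on L b X /\ within L c X,
    forall a, a \in L -> alookup a.1 res = row (X a.1) &
    (forall v i, S (b v i)) -> (forall a, a \in L -> S (c a.1)) ->
    forall a i, a \in L -> S (X a.1 i)].

Lemma sum_incidence (x y : 'I_n) : (\sum_v incidence R (x, y) v = 0 :> R)%R.
Proof.
have h (z : 'I_n) : (\sum_v ((z == v)%:R : R) = 1)%R.
  by rewrite (bigD1 z) //= eqxx big1 ?addr0 // => v /negPf; rewrite eq_sym => ->.
by rewrite /incidence sumrB /= !h subrr.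
Qed.

Lemma enc_arc_seq_update c e r M : e \notin unzip1 M ->
  enc_arc_seq (update c e r) M = enc_arc_seq c M.
Proof.
move=> eM; congr enc_seq; apply/eq_in_map => a aM.
rewrite /enc_arc /update; case: eqP => // ae; by rewrite -ae map_f in eM.
Qed.

(** The only candidate is the demand row of the tail. Balance at the head follows as the demands add
    up to 0 and vanish elsewhere; what is left to test are signs and capacity. *)
Lemma call_solve_arc S (a : 'I_m * ('I_n * 'I_n)) c b tbl :
  a.2.1 != a.2.2 -> size tbl <= 4 * N ->
  (forall v : 'I_n, alookup v tbl = row (b v)) ->
  (forall v, ~~ touches v [:: a.2] -> forall i, b v i = 0%R) ->
  (forall i, \sum_v b v i = 0)%R ->
  exists2 out, solution S [:: a] c b out &
    ev [:: Nil; enc_arc_seq c [:: a]; enc_assoc tbl; Pair (enc_arc_seq c [:: a]) (enc_assoc tbl)]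
      solve_arc_body out (lookup_time + 4 * row_time + 100).
Proof.
case: a => e [x y] /= xy stbl tblb b0 sb.
have xN : x < N by apply: leq_trans nN.
have hl := call_lookup_key xN stbl; rewrite tblb in hl.
have hs := call_sum_row (b x).
have hp := call_pos_row (b x).
have hps := call_sum_row (fun i => if 0 <= b x i then b x i else 0)%R.
have Xx X i : flow_on [:: (e, (x, y))] b X -> X e i = b x i.
  move=> [_ /(_ x i)]; rewrite big_seq1 /incidence /= eqxx eq_sym (negPf xy) => <-.
  by rewrite subr0 mulr1.
have fb : (forall i, 0 <= b x i)%R -> flow_on [:: (e, (x, y))] b (fun=> b x).
  move=> bx0; split=> [a i _|v i]; first exact: bx0.
  rewrite big_seq1 /incidence /=.
  case: (eqVneq x v) => [<-|xv]; first by rewrite eq_sym (negPf xy) subr0 mulr1.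
  case: (eqVneq y v) => [<-|yv].
    have := sb i; rewrite (bigD1 x) //= (bigD1 y) //= 1?eq_sym // big1 => [|z /andP[zx zy]].
      by rewrite addr0 sub0r mulrN1 => /eqP; rewrite addrC addr_eq0 => /eqP ->; ring.
    by apply: b0; rewrite /= orbF negb_or ![_ == z]eq_sym zx.
  by rewrite subrr mulr0 b0 //= orbF negb_or xv.
have le_pos : (\sum_i b x i <= \sum_i (if 0 <= b x i then b x i else 0))%R.
  by apply: ler_sum => i _; case: ifP => // /negbT; rewrite -ltNge => /ltW.
case: (leP (\sum_i (if 0 <= b x i then b x i else 0)) (\sum_i b x i))%R => [c1|c1]; last first.
  exists Nil; first left; first split=> // X fX.
    move=> _; suff: (\sum_i (if 0 <= b x i then b x i else 0) = \sum_i b x i)%R.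
      by move=> E; rewrite E ltxx in c1.
    apply: eq_bigr => i _; rewrite ifT // -(Xx X i fX).
    by apply: (fX.1 (e, (x, y))); rewrite mem_head.
  eapply ev_weaken.
    do 4!(eapply ev_match_pair; [ev_value|]).
    eapply ev_let; [ev_steps; exact: hl|].
    eapply ev_let; [ev_steps; exact: hs|].
    eapply ev_ifle; [ev_steps; [exact: hp|exact: hps]|ev_value|].
    by rewrite leNgt c1; ev_steps.
  by clear; lia.
case: (leP (\sum_i b x i) (c e))%R => [c2|c2]; last first.
  exists Nil; first left; first split=> // X fX.
    move=> /(_ _ (mem_head _ _)) /=; rewrite (eq_bigr (b x)) => [|i _]; last exact: Xx.
    by rewrite leNgt c2.
  eapply ev_weaken.
    do 4!(eapply ev_match_pair; [ev_value|]).
    eapply ev_let; [ev_steps; exact: hl|].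
    eapply ev_let; [ev_steps; exact: hs|].
    eapply ev_ifle; [ev_steps; [exact: hp|exact: hps]|ev_value|].
    rewrite c1; eapply ev_ifle; [ev_value|ev_value|].
    by rewrite leNgt c2; ev_steps.
  by clear; lia.
(* A single negative entry would make the sum of the positive parts strictly larger, against
   [c1]. *)
have bx0 i : (0 <= b x i)%R.
  rewrite leNgt; apply/negP => bxi.
  suff: (\sum_i b x i < \sum_i (if 0 <= b x i then b x i else 0))%R by rewrite ltNge c1.
  rewrite [ltRHS](bigD1 i) //= [ltLHS](bigD1 i) //= ifF; last by rewrite leNgt bxi.
  apply: ltr_leD => //; apply: ler_sum => j _.
  by case: ifP => // /negbT; rewrite -ltNge => /ltW.
exists (enc_assoc [:: (e : nat, row (b x))]).
  right; exists [:: (e : nat, row (b x))], (fun=> b x); split=> //.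
  - by split; [exact: fb|move=> a; rewrite inE => /eqP ->].
  - by move=> a; rewrite inE => /eqP ->; rewrite /= eqxx.
eapply ev_weaken.
  do 4!(eapply ev_match_pair; [ev_value|]).
  eapply ev_let; [ev_steps; exact: hl|].
  eapply ev_let; [ev_steps; exact: hs|].
  eapply ev_ifle; [ev_steps; [exact: hp|exact: hps]|ev_value|].
  rewrite c1; eapply ev_ifle; [ev_value|ev_value|].
  by rewrite c2; ev_steps.
by clear; lia.
Qed.

Lemma uniq_unzip1_cons2 e f a a' M :
  uniq (unzip1 [:: (e, a), (f, a') & M]) ->
  [/\ e != f, e \notin unzip1 M, f \notin unzip1 M & uniq (unzip1 M)].
Proof. by case/andP; rewrite inE negb_or => /andP[-> ->] /andP[]. Qed.

(* The entries for [e] and [f] shadow the older entry of the merged arc [e]. *)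
Lemma alookup_cons2 (e f : 'I_m) a a' M X X' res (r s : 'I_k -> R) :
  uniq (unzip1 [:: (e, a), (f, a') & M]) ->
  X e =1 r -> X f =1 s -> (forall d, d \in M -> X d.1 = X' d.1) ->
  (forall d, d \in M -> alookup d.1 res = row (X' d.1)) ->
  forall d, d \in [:: (e, a), (f, a') & M] ->
    alookup d.1 [:: (e : nat, row r), (f : nat, row s) & res] = row (X d.1).
Proof.
move=> /uniq_unzip1_cons2[ef eM fM _] Xe Xf XX' h d.
rewrite !inE => /or3P[/eqP->|/eqP->|dM] /=.
- by rewrite eqxx; apply: eq_row => i; rewrite Xe.
- by rewrite val_eqE eq_sym (negPf ef) eqxx; apply: eq_row => i; rewrite Xf.
rewrite !val_eqE !ifF ?h ?XX' //.
  by apply: contraNF fM => /eqP <-; apply: map_f.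
by apply: contraNF eM => /eqP <-; apply: map_f.
Qed.

Lemma update2_rest (T : Type) e f a a' M (X : 'I_m -> T) r s d :
  uniq (unzip1 [:: (e, a), (f, a') & M]) -> d \in M ->
  update (update X e r) f s d.1 = X d.1.
Proof.
move=> /uniq_unzip1_cons2[ef eM fM _] dM; rewrite /update !ifF //.
  by apply: contraNF eM => /eqP <-; apply: map_f.
by apply: contraNF fM => /eqP <-; apply: map_f.
Qed.

Lemma update2_first (T : Type) e f (X : 'I_m -> T) r s :
  e != f -> update (update X e r) f s e = r.
Proof. by move=> ef; rewrite /update (negPf ef) eqxx. Qed.

Lemma update2_second (T : Type) e f (X : 'I_m -> T) r s :
  update (update X e r) f s f = s.
Proof. by rewrite /update eqxx. Qed.

Lemma within_rest e a M c X (x : R) (g : 'I_k -> R) : e \notin unzip1 M ->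
  within M c X -> (\sum_i g i <= x)%R -> within ((e, a) :: M) (update c e x) (update X e g).
Proof.
move=> eM wX gx d; rewrite inE /update => /predU1P[->|dM]; first by rewrite /= eqxx.
rewrite ifN ?ifN; [exact: wX| |]; by apply: contra eM => /eqP <-; apply: map_f.
Qed.

(** Adding the capacities loses nothing: the greedy split fills [e] up to [c e] and leaves at most
    [c f]. The variables [d1] to [d11] and [env] stand for environment entries that the body does
    not read. *)
Lemma call_solve_parallel S e f x y M c b (tbl : value R) out T :
  difference_closed S ->
  uniq (unzip1 [:: (e, (x, y)), (f, (x, y)) & M]) -> size M < N ->
  (forall a, a \in [:: (e, (x, y)), (f, (x, y)) & M] -> 0 <= c a.1)%R ->
  let A' := (e, (x, y)) :: M in
  let c' := update c e (c e + c f)%R in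
  call 12 (Pair (enc_arc_seq c' A') tbl) out T ->
  solution S A' c' b out ->
  exists2 out', solution S [:: (e, (x, y)), (f, (x, y)) & M] c b out' &
    forall d1 d2 d3 d4 d5 d6 d7 d8 d9 d10 d11 env,
    ev [:: enc_nat R y, Scalar (c f), enc_nat R x, d1, enc_nat R f, d2, enc_nat R y,
           Scalar (c e), enc_nat R x, d3, enc_nat R e, d4, d5, enc_arc_seq c M, d6,
           d7, d8, d9, d10, d11, tbl & env]
      solve_parallel_body out' (T + lookup_time + 2 * row_time + 100).
Proof.
move=> hS uA sM c0 A' c' hc sol.
have [ef eM fM uM] := uniq_unzip1_cons2 uA.
have Mval : enc_arc_seq c' M = enc_arc_seq c M by rewrite enc_arc_seq_update.
have Aval : enc_arc_seq c' A' =
    Pair (Pair (enc_nat R e) (Pair (enc_nat R x) (Pair (enc_nat R y) (Scalar (c e + c f)%R))))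
      (enc_arc_seq c M).
  by rewrite -Mval /enc_arc_seq /= /enc_arc /= /c' /update eqxx.
rewrite Aval in hc.
case: sol => [[outN infeasible]|[res [X [outE sres [fX wX] Xres SX]]]].
  exists Nil.
    left; split=> // X fX wX; have := flow_parallel_merge uA fX; move/infeasible; apply.
    have wM : within M c X by move=> a aM; apply: wX; rewrite !inE aM !orbT.
    apply: within_rest => //; rewrite big_split /= lerD //.
      by apply: (wX (e, (x, y))); rewrite mem_head.
    by apply: (wX (f, (x, y))); rewrite !inE eqxx orbT.
  move=> *; eapply ev_weaken.
    eapply ev_let; first by ev_steps; exact: hc.
    by rewrite outN; eapply ev_match_nil; ev_steps.
  by clear; lia.
have eh : (e, (x, y)) \in A' by rewrite mem_head.
have fh : (f, (x, y)) \in [:: (e, (x, y)), (f, (x, y)) & M] by rewrite !inE eqxx orbT.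
have X0 i : (0 <= X e i)%R := fX.1 _ i eh.
have ce0 : (0 <= c e)%R by apply: (c0 (e, (x, y))); rewrite mem_head.
have cf0 : (0 <= c f)%R := c0 _ fh.
have [g [gE g0 Sg gs]] := fill_spec hS (enum_uniq 'I_k) X0 ce0.
rewrite !big_enum /= in gs.
have Xs : (\sum_i X e i <= c e + c f)%R.
  by have := wX _ eh; rewrite /c' /update /= eqxx.
exists (enc_assoc [:: (e : nat, row g), (f : nat, row (fun i => X e i - g i)%R) & res]).
  right; exists [:: (e : nat, row g), (f : nat, row (fun i => X e i - g i)%R) & res].
  exists (update (update X e g) f (fun i => X e i - g i)%R); split=> //.
  - by move: sres sM; clear; rewrite /=; lia.
  - split; first exact: flow_parallel_split.
    move=> a; rewrite !inE => /or3P[/eqP->|/eqP->|aM].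
    + by rewrite update2_first // gs ge_min lexx.
    + rewrite update2_second sumrB gs lerBlDl -lerBlDr minElt.
      by case: ifP => _; rewrite lerBlDr ?lerDl // addrC.
    + rewrite (update2_rest _ _ _ uA aM).
      have := wX a; rewrite inE aM orbT => /(_ isT); rewrite /c' /update ifN //.
      by apply: contra eM => /eqP <-; apply: map_f.
  - apply: (alookup_cons2 (X' := X) uA).
    + by move=> i; rewrite update2_first.
    + by move=> i; rewrite update2_second.
    + by move=> d dM; rewrite (update2_rest _ _ _ uA dM).
    + by move=> d dM; apply: Xres; rewrite inE dM orbT.
  - move=> Sb Sc.
    have Sce : S (c e) by apply: (Sc (e, (x, y))); rewrite mem_head.
    have Scf : S (c f) := Sc _ fh.
    have {}SX a i : a \in A' -> S (X a.1 i).
      move: a i; apply: SX => // a; rewrite /c' /update inE => /predU1P[->|aM] /=.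
        by rewrite eqxx; apply: difference_closedD.
      rewrite ifN; first by apply: Sc; rewrite !inE aM !orbT.
      by apply: contra eM => /eqP <-; apply: map_f.
    have {}Sg i : S (g i) by apply: Sg => // j; apply: (SX _ j eh).
    move=> a i; rewrite !inE => /or3P[/eqP->|/eqP->|aM].
    + by rewrite update2_first.
    + by rewrite update2_second; apply: hS.2 => //; apply: (SX _ i eh).
    + by rewrite (update2_rest _ _ _ uA aM); apply: SX; rewrite inE aM orbT.
have hl : call 2 (Pair (enc_nat R e) (enc_assoc res)) (enc_reals (row (X e))) lookup_time.
  rewrite -(Xres _ eh); apply: call_lookup_key; first exact: leq_trans (ltn_ord e) mN.
  by move: sres sM; clear; rewrite /=; lia.
have hf := call_fill_row (X e) (c e).
have hsub := call_sub_row (X e) g.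
rewrite -gE in hf.
move=> *; rewrite outE in hc.
case: res sres {outE Xres} hc hl => [//|h res] _ hc hl.
eapply ev_weaken.
  eapply ev_let; first by ev_steps; exact: hc.
  eapply ev_match_pair; [ev_value|].
  eapply ev_let; first by ev_steps; exact: hl.
  eapply ev_let; first by ev_steps; exact: hf.
  by ev_steps; exact: hsub.
by clear; lia.
Qed.

Lemma shift_demand_tail b (x w y : 'I_n) i : x != w -> x != y ->
  shift_demand b x w y x i = (b x i - deficit b w i)%R.
Proof.
move=> xw xy; rewrite /shift_demand /incidence /= eqxx ![_ == x]eq_sym (negPf xw) (negPf xy).
rewrite mulr0n mulr1n; ring.
Qed.

Lemma shift_demand_head b (x w y : 'I_n) i : w != y -> x != y ->
  shift_demand b x w y y i = (b y i + surplus b w i)%R.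
Proof.
move=> wy xy; rewrite /shift_demand /incidence /= eqxx (negPf wy) (negPf xy).
rewrite mulr0n mulr1n; ring.
Qed.

Lemma shift_demand_mid b (x w y : 'I_n) i : x != w -> w != y ->
  shift_demand b x w y w i = 0%R.
Proof.
move=> xw wy; rewrite /shift_demand /incidence /= eqxx (negPf xw) [y == w]eq_sym (negPf wy).
rewrite mulr0n mulr1n /deficit; ring.
Qed.

Lemma shift_demand_other b (x w y v : 'I_n) i : v != x -> v != w -> v != y ->
  shift_demand b x w y v i = b v i.
Proof.
rewrite ![v == _]eq_sym => /negPf vx /negPf vw /negPf vy.
by rewrite /shift_demand /incidence /= vx vw vy subrr !mulr0 !subr0.
Qed.

(** The recursive call enters as a hypothesis for every capacity vector and every table of the
    shifted demands, because both are computed within the body. *)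
Lemma call_solve_series S e f (x w y : 'I_n) M c b tbl T :
  difference_closed S ->
  uniq (unzip1 [:: (e, (x, w)), (f, (w, y)) & M]) -> size M < N ->
  x != w -> w != y -> x != y -> ~~ touches w (unzip2 M) ->
  size tbl <= 4 * N ->
  (forall v : 'I_n, alookup v tbl = row (b v)) ->
  (forall a, a \in [:: (e, (x, w)), (f, (w, y)) & M] -> 0 <= c a.1)%R ->
  let A' := (e, (x, y)) :: M in
  let b' := shift_demand b x w y in
  (forall c' tbl', (forall a, a \in A' -> 0 <= c' a.1)%R ->
     size tbl' = (size tbl + 3)%N ->
     (forall v : 'I_n, alookup v tbl' = row (b' v)) ->
     exists2 out, solution S A' c' b' out &
       call 12 (Pair (enc_arc_seq c' A') (enc_assoc tbl')) out T) ->
  exists2 out', solution S [:: (e, (x, w)), (f, (w, y)) & M] c b out' &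
    forall d1 d2 d3 d4 d5 d6 d7 d8 d9 d10 d11 d12 d13 env,
    ev [:: d1, d2, enc_nat R y, Scalar (c f), enc_nat R w, d3, enc_nat R f, d4, enc_nat R w,
           Scalar (c e), enc_nat R x, d5, enc_nat R e, d6, d7, enc_arc_seq c M, d8,
           d9, d10, d11, d12, d13, enc_assoc tbl & env]
      solve_series_body out' (T + 4 * lookup_time + 10 * row_time + 300).
Proof.
move=> hS uA sM xw wy xy wM stbl tblb c0 A' b' rec.
have [ef eM fM uM] := uniq_unzip1_cons2 uA.
have lN (v : 'I_n) : v < N by apply: leq_trans nN.
have hb (v : 'I_n) := call_lookup_key (lN v) stbl.
have hw := hb w; have hx := hb x; have hy := hb y; rewrite !tblb in hw hx hy.
have hpos := call_pos_row (b w).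
rewrite -/(surplus b w) in hpos.
have hneg := call_sub_row (surplus b w) (b w).
rewrite -/(deficit b w) in hneg.
have hsn := call_sum_row (deficit b w).
have hsp := call_sum_row (surplus b w).
have hx' := call_sub_row (b x) (deficit b w).
have hy' := call_add_row (b y) (surplus b w).
have hw' := call_sub_row (b w) (b w).
have bal X : flow_on [:: (e, (x, w)), (f, (w, y)) & M] b X ->
    (forall i, X f i - X e i = b w i)%R.
  by move=> fX; apply: flow_series_balance wM fX.
(* The residual capacities once the forced flow is reserved. The merged arc gets the smaller one,
   and a negative value refutes feasibility. *)
pose c1 := (c e - \sum_i deficit b w i)%R; pose c2 := (c f - \sum_i surplus b w i)%R.
pose c3 := (if c2 <= c1 then c2 else c1)%R.
have c3min : c3 = Num.min c2 c1 by rewrite /c3; case: leP.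
have infeas out : out = Nil -> (forall X, flow_on A' b' X -> ~ within A' (update c e c3) X) ->
    solution S [:: (e, (x, w)), (f, (w, y)) & M] c b out.
  move=> -> h; left; split=> // X fX wX.
  apply: (h _ (flow_series_merge uA xw wy wM fX)).
  have wM' : within M c X by move=> a aM; apply: wX; rewrite !inE aM !orbT.
  apply: within_rest => //; rewrite c3min le_min; apply/andP; split.
    rewrite (eq_bigr (fun i => X f i - surplus b w i)%R) => [|i _]; last first.
      by rewrite /deficit -(bal _ fX); ring.
    by rewrite sumrB lerB //; apply: (wX (f, (w, y))); rewrite !inE eqxx orbT.
  by rewrite sumrB lerB //; apply: (wX (e, (x, w))); rewrite mem_head.
(* The common beginning of the three runs: negative capacity, infeasible recursive call, success. *)
have head d1 d2 d3 d4 d5 d6 d7 d8 d9 d10 d11 d12 d13 env e1 out T1 :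
  ev [:: Scalar c3, Scalar c2, Scalar c1, enc_reals (row (deficit b w)),
         enc_reals (row (surplus b w)), enc_reals (row (b w)),
         d1, d2, enc_nat R y, Scalar (c f), enc_nat R w, d3, enc_nat R f, d4, enc_nat R w,
           Scalar (c e), enc_nat R x, d5, enc_nat R e, d6, d7, enc_arc_seq c M, d8,
           d9, d10, d11, d12, d13, enc_assoc tbl & env] e1 out T1 ->
  ev [:: d1, d2, enc_nat R y, Scalar (c f), enc_nat R w, d3, enc_nat R f, d4, enc_nat R w,
           Scalar (c e), enc_nat R x, d5, enc_nat R e, d6, d7, enc_arc_seq c M, d8,
           d9, d10, d11, d12, d13, enc_assoc tbl & env]
     (ELet (ECall 2 (EPair (EVar 8) (EVar 22)))
     (ELet (ECall 5 (EVar 0))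
     (ELet (ECall 4 (EPair (EVar 0) (EVar 1)))
     (ELet (ESub (EVar 12) (ECall 6 (EVar 0)))
     (ELet (ESub (EVar 7) (ECall 6 (EVar 2)))
     (ELet (EIfLe (EVar 0) (EVar 1) (EVar 0) (EVar 1)) e1)))))) out
     (T1 + lookup_time + 4 * row_time + 100).
  move=> h; eapply ev_weaken.
    eapply ev_let; first by ev_steps; exact: hw.
    eapply ev_let; first by ev_steps; exact: hpos.
    eapply ev_let; first by ev_steps; exact: hneg.
    eapply ev_let; first by ev_steps; exact: hsn.
    eapply ev_let; first by ev_steps; exact: hsp.
    eapply ev_let; last exact: h.
    by eapply ev_ifle; [ev_value|ev_value|rewrite /c3 -/c1 -/c2; case: ifP => _; ev_steps].
  by clear; lia.
have [c30|c30] := leP 0%R c3; last first.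
  exists Nil.
    apply: infeas => // X fX /(_ _ (mem_head _ _)); rewrite /update /= eqxx => h.
    have : (0 <= \sum_i X e i)%R by apply: sumr_ge0 => i _; apply: (fX.1 _ i (mem_head _ _)).
    by rewrite leNgt (le_lt_trans h c30).
  move=> *; eapply ev_weaken.
    apply: head; eapply ev_ifle; [ev_steps|ev_value|].
    by rewrite leNgt c30; ev_steps.
  by clear; lia.
pose tbl' := [:: (x : nat, row (fun i => b x i - deficit b w i)%R),
                 (y : nat, row (fun i => b y i + surplus b w i)%R),
                 (w : nat, row (fun i => b w i - b w i)%R) & tbl].
have [||| out sol hc] := rec (update c e c3) tbl'.
- move=> a; rewrite inE /update => /predU1P[->|aM]; first by rewrite /= eqxx.
  by case: ifP => // _; apply: c0; rewrite !inE aM !orbT.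
- by rewrite /= addn3.
- move=> v; rewrite /= !val_eqE.
  case: (eqVneq v x) => [->|vx]; first by apply: eq_row => i; rewrite /b' shift_demand_tail.
  case: (eqVneq v y) => [->|vy]; first by apply: eq_row => i; rewrite /b' shift_demand_head.
  case: (eqVneq v w) => [->|vw].
    by apply: eq_row => i; rewrite /b' shift_demand_mid // subrr.
  by rewrite tblb; apply: eq_row => i; rewrite /b' shift_demand_other.
have Mval : enc_arc_seq (update c e c3) M = enc_arc_seq c M by rewrite enc_arc_seq_update.
have Aval : enc_arc_seq (update c e c3) A' =
    Pair (Pair (enc_nat R e) (Pair (enc_nat R x) (Pair (enc_nat R y) (Scalar c3))))
      (enc_arc_seq c M).
  by rewrite -Mval /enc_arc_seq /= /enc_arc /= /update eqxx.
rewrite Aval in hc.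
case: sol => [[outN inf]|[res [X [outE sres [fX wX] Xres SX]]]].
  exists Nil; first exact: infeas.
  move=> *; eapply ev_weaken.
    apply: head; eapply ev_ifle; [ev_steps|ev_value|rewrite c30].
    eapply ev_let; first by ev_steps; [exact: hx|exact: hx'|exact: hy|exact: hy'|exact: hw'|exact: hc].
    by rewrite outN; eapply ev_match_nil; ev_steps.
  by clear; lia.
have eh : (e, (x, y)) \in A' by rewrite mem_head.
have fh : (f, (w, y)) \in [:: (e, (x, w)), (f, (w, y)) & M] by rewrite !inE eqxx orbT.
have Xs : (\sum_i X e i <= c3)%R by have := wX _ eh; rewrite /update /= eqxx.
have /andP[Xs2 Xs1] : ((\sum_i X e i <= c2) && (\sum_i X e i <= c1))%R.
  by rewrite -le_min -c3min.
exists (enc_assoc [:: (e : nat, row (fun i => X e i + deficit b w i)%R),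
                      (f : nat, row (fun i => X e i + surplus b w i)%R) & res]).
  right; exists [:: (e : nat, row (fun i => X e i + deficit b w i)%R),
                    (f : nat, row (fun i => X e i + surplus b w i)%R) & res].
  exists (update (update X e (fun i => X e i + deficit b w i))
                 f (fun i => X e i + surplus b w i))%R; split=> //.
  - by move: sres sM; clear; rewrite /=; lia.
  - split; first exact: flow_series_split.
    move=> a; rewrite !inE => /or3P[/eqP->|/eqP->|aM].
    + by rewrite update2_first // big_split /= -lerBrDr.
    + by rewrite update2_second big_split /= -lerBrDr.
    + rewrite (update2_rest _ _ _ uA aM).
      have := wX a; rewrite inE aM orbT => /(_ isT); rewrite /update ifN //.
      by apply: contra eM => /eqP <-; apply: map_f.
  - apply: (alookup_cons2 (X' := X) uA).
    + by move=> i; rewrite update2_first.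
    + by move=> i; rewrite update2_second.
    + by move=> d dM; rewrite (update2_rest _ _ _ uA dM).
    + by move=> d dM; apply: Xres; rewrite inE dM orbT.
  - move=> Sb Sc.
    have Sdef i : S (deficit b w i) by apply: deficit_closed.
    have Ssur i : S (surplus b w i) by apply: surplus_closed.
    have Sc3 : S c3.
      rewrite /c3; case: ifP => _; apply: hS.2; rewrite ?difference_closed_sum //.
        exact: (Sc _ fh).
      by apply: (Sc (e, (x, w))); rewrite mem_head.
    have {}SX a i : a \in A' -> S (X a.1 i).
      move: a i; apply: SX => [|a]; first exact: shift_demand_closed.
      rewrite /update inE => /predU1P[->|aM] /=; first by rewrite eqxx.
      rewrite ifN; first by apply: Sc; rewrite !inE aM !orbT.
      by apply: contra eM => /eqP <-; apply: map_f.
    move=> a i; rewrite !inE => /or3P[/eqP->|/eqP->|aM].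
    + by rewrite update2_first //; apply: difference_closedD => //; apply: (SX _ i eh).
    + by rewrite update2_second; apply: difference_closedD => //; apply: (SX _ i eh).
    + by rewrite (update2_rest _ _ _ uA aM); apply: SX; rewrite inE aM orbT.
have hl : call 2 (Pair (enc_nat R e) (enc_assoc res)) (enc_reals (row (X e))) lookup_time.
  rewrite -(Xres _ eh); apply: call_lookup_key; first exact: leq_trans (ltn_ord e) mN.
  by move: sres sM; clear; rewrite /=; lia.
have h1 := call_add_row (X e) (deficit b w).
have h2 := call_add_row (X e) (surplus b w).
move=> *; rewrite outE in hc.
case: res sres {outE Xres} hc hl => [//|h res] _ hc hl.
eapply ev_weaken.
  apply: head; eapply ev_ifle; [ev_steps|ev_value|rewrite c30].
  eapply ev_let; first by ev_steps; [exact: hx|exact: hx'|exact: hy|exact: hy'|exact: hw'|exact: hc].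
  eapply ev_match_pair; [ev_value|].
  eapply ev_let; first by ev_steps; exact: hl.
  by ev_steps; [exact: h1|exact: h2].
by clear; lia.
Qed.

Lemma solution_perm S L M c b out : perm_eq L M -> solution S L c b out -> solution S M c b out.
Proof.
move=> LM; have mLM := perm_mem LM.
case=> [[-> h]|[res [X [-> sres [fX wX] Xres SX]]]].
  left; split=> // X fX wX; apply: (h X).
    by apply: flow_on_perm fX; rewrite perm_sym.
  by move=> a; rewrite mLM; apply: wX.
right; exists res, X; split=> //; first by rewrite -(perm_size LM).
- by split; [apply: flow_on_perm fX|move=> a; rewrite -mLM; apply: wX].
- by move=> a; rewrite -mLM; apply: Xres.
- by move=> Sb Sc a i; rewrite -mLM; apply: SX => // a'; rewrite mLM; apply: Sc.
Qed.

(** Induction on the number of arcs. In [size tbl + 3 * size L] a lost arc pays for the three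
    entries of a series step. Zero sums and zero demand at untouched nodes survive both reductions
    and make the last arc solvable from its tail. *)
Lemma call_solve S L c b tbl : difference_closed S ->
  reducible (unzip2 L) -> uniq (unzip1 L) -> size L <= N ->
  size tbl + 3 * size L <= 4 * N ->
  (forall v : 'I_n, alookup v tbl = row (b v)) ->
  (forall v, ~~ touches v (unzip2 L) -> forall i, b v i = 0%R) ->
  (forall i, \sum_v b v i = 0)%R ->
  (forall a, a \in L -> 0 <= c a.1)%R ->
  exists2 out, solution S L c b out &
    call 12 (Pair (enc_arc_seq c L) (enc_assoc tbl)) out ((size L).+1 * level_time).
Proof.
move=> hS; move E: (size L) => l.
elim: l L E c b tbl => [|l IH] L E c b tbl redL uL lN stbl tblb b0 sb c0.
  by move/size0nil: E redL => -> redL; inversion redL as [| ? ? ? ? p | ? ? ? ? ? p]; have := perm_size p.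
have hf : call 11 (Pair Nil (enc_arc_seq c L)) (enc_found c (find_pair [::] L))
    (N.+1 * pair_time N N).
  apply: call_weaken (@call_find_pair R main _ _ _ nN c [::] L N _) _; first by rewrite E.
  by rewrite E leq_mul.
case Ef: (find_pair [::] L) hf => [[[[s A] B] M]|] hf; last first.
  have [a La axy] := find_pair_none Ef redL; subst L.
  have [|out sol h] := call_solve_arc S c axy _ tblb b0 sb; first by move: stbl; clear; lia.
  exists out; first exact: sol.
  ev_fun.
    eapply ev_match_pair; [ev_value|].
    eapply ev_let; first by ev_steps; exact: hf.
    by eapply ev_match_nil; [ev_value|exact: h].
  by rewrite /level_time; clear; lia.
have [p r] := find_pair_sound Ef.
rewrite /= in p.
have sM : size L = (size M).+2 by rewrite (perm_size p).
case: A B p r hf Ef => e [x y] [f [x' y']] p r hf Ef.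
have uA : uniq (unzip1 [:: (e, (x, y)), (f, (x', y')) & M]).
  by rewrite -(perm_uniq (perm_map fst p)).
have c0' a : a \in [:: (e, (x, y)), (f, (x', y')) & M] -> (0 <= c a.1)%R.
  by rewrite -(perm_mem p); apply: c0.
have uA' (a : 'I_n * 'I_n) : uniq (unzip1 ((e, a) :: M)).
  by have [_ eM _ uM] := uniq_unzip1_cons2 uA; rewrite /= eM.
have p2 := perm_map snd p.
(* The pair found may differ from the first step of the derivation of [redL]; confluence keeps the
   remaining list reducible. *)
have [confP confS] := reducible_confluent redL.
have sMN : size M < N by move: sM lN; rewrite E => -[->]; exact: ltnW.
have sA (a : 'I_m * ('I_n * 'I_n)) : size (a :: M) = l by move: sM; rewrite E => -[->].
have stbl' : size tbl <= 4 * N by move: stbl; clear; lia.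
suff [out sol h] : exists2 out, solution S [:: (e, (x, y)), (f, (x', y')) & M] c b out &
    forall arg env, ev [:: enc_bool R s, Pair (enc_arc c (e, (x, y)))
         (Pair (enc_arc c (f, (x', y'))) (enc_arc_seq c M)), arg, enc_arc_seq c L, enc_assoc tbl & env]
      (EMatch (EVar 1) ENil (EMatch (EVar 1) ENil
      (EMatch (EVar 2) ENil (EMatch (EVar 1) ENil (EMatch (EVar 1) ENil
      (EMatch (EVar 6) ENil (EMatch (EVar 1) ENil (EMatch (EVar 1) ENil
      (EMatch (EVar 16) solve_parallel_body solve_series_body))))))))) out
      (l.+1 * level_time + 4 * lookup_time + 10 * row_time + 400).
  exists out; first by apply: solution_perm sol; rewrite perm_sym.
  ev_fun.
    eapply ev_match_pair; [ev_value|].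
    eapply ev_let; first by ev_steps; exact: hf.
    by eapply ev_match_pair; [ev_value|exact: h].
  by have := erefl (level_time); rewrite {2}/level_time; clear; lia.
case: s r {hf Ef} => [[/= xy wM]|[/= ex ey]].
  subst x'.
  have redA := confS _ _ _ _ p2 wM.
  have xy : x != y.
    by apply: (reducible_loopless redL (a := (x, y))); rewrite (perm_mem p2) mem_head.
  have yy : y != y'.
    by apply: (reducible_loopless redL (a := (y, y'))); rewrite (perm_mem p2) !inE eqxx orbT.
  have xy' : x != y' := reducible_loopless redA (mem_head _ _).
  have [|out sol h] := @call_solve_series S e f x y y' M c b tbl (l.+1 * level_time)
    hS uA sMN xy yy xy' wM stbl' tblb c0'.
    move=> c' tbl' c'0 stbl2 tblb'; apply: IH => //.
    - exact: ltnW.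
    - by move: stbl stbl2; clear; lia.
    - move=> v; rewrite /= -/(touches v (unzip2 M)) => /norP[/norP[vx vy'] vM] i.
      case: (eqVneq v y) => [->|vy]; first exact: shift_demand_mid.
      have [vx1 vy1] : v != x /\ v != y' by rewrite ![v == _]eq_sym.
      rewrite shift_demand_other //; apply: b0.
      rewrite (touches_perm _ p2) /= -/(touches v (unzip2 M)).
      by rewrite !negb_or vx vy' vM ![y == _]eq_sym vy.
    - move=> i; rewrite !sumrB sb -!mulr_sumr !sum_incidence; ring.
  exists out => // arg env; eapply ev_weaken.
    do 8!(eapply ev_match_pair; [ev_value|]).
    by eapply ev_match_pair; [ev_value|exact: h].
  by clear; lia.
subst x' y'.
have redA := confP _ _ _ p2.
have [||||||out' sol' hc] := IH ((e, (x, y)) :: M) (sA _) (update c e (c e + c f)%R) b tbl redA (uA' _).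
- exact: ltnW.
- by move: stbl; clear; lia.
- exact: tblb.
- move=> v; rewrite /= -/(touches v (unzip2 M)) => h i; apply: b0.
  rewrite (touches_perm _ p2) /= -/(touches v (unzip2 M)).
  by case/norP: h => /norP[h1 h2] h3; rewrite !negb_or h1 h2 h3.
- exact: sb.
- move=> a; rewrite inE /update => /predU1P[->|aM] /=.
    rewrite eqxx addr_ge0 //; first by apply: (c0' (e, (x, y))); rewrite mem_head.
    by apply: (c0' (f, (x, y))); rewrite !inE eqxx orbT.
  by case: ifP => _; [rewrite addr_ge0 //; [apply: (c0' (e, (x, y)))|apply: (c0' (f, (x, y)))]|apply: c0'];
    rewrite !inE ?eqxx ?aM ?orbT.
have [out sol h] := call_solve_parallel hS uA sMN c0' hc sol'.
exists out => // arg env; eapply ev_weaken.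
  do 8!(eapply ev_match_pair; [ev_value|]).
  by eapply ev_match_nil; [ev_value|exact: h].
by clear; lia.
Qed.

End Solve.

(** * Translating between instances and the solver's tables *)

Section Interface.
Variables (R : realType) (main : expr).
Local Notation ev := (evaluates main).
Local Notation call := (calls main).

(** The common format of arcs and commodities, so [total_body] sums capacities as well as
    demands. *)
Definition enc_triples (T : Type) (u v : T -> value R) (f : T -> R) (l : seq T) : value R :=
  enc_seq [seq Pair (u i) (Pair (v i) (Scalar (f i))) | i <- l].

Lemma call_total (T : Type) (u v : T -> value R) f (l : seq T) :
  call 13 (enc_triples u v f l) (Scalar (\sum_(i <- l) f i)%R) (20 * (size l).+1).
Proof.
elim: l => [|x l IH]; ev_fun; [by rewrite big_nil; ev_steps|by []| |].
  by rewrite big_cons; ev_steps; exact: IH.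
by rewrite /=; lia.
Qed.

Lemma call_demands (T : Type) (u v : T -> value R) f (l : seq T) :
  call 20 (enc_triples u v f l) (enc_seq [seq Scalar (f i) | i <- l]) (20 * (size l).+1).
Proof.
elim: l => [|x l IH]; ev_fun; [by ev_steps|by []| |].
  by ev_steps; exact: IH.
by rewrite /=; lia.
Qed.

Lemma call_label (T : Type) (F : T -> value R) (g : T -> nat) (l : seq T) j :
  [seq g i | i <- l] = iota j (size l) ->
  call 14 (Pair (enc_nat R j) (enc_seq [seq F i | i <- l]))
    (enc_seq [seq Pair (enc_nat R (g i)) (F i) | i <- l]) (20 * (size l).+1).
Proof.
elim: l j => [|x l IH] j; first by move=> _; ev_fun; [by ev_steps|].
case=> <- gl; ev_fun; first by ev_steps; exact: (IH (g x).+1).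
by rewrite /=; lia.
Qed.

Lemma call_gadget (T : Type) (F : T -> value R) (g : T -> nat) (l : seq T) j (c : R) :
  [seq g i | i <- l] = iota j (size l) ->
  call 19 (Pair (enc_seq [seq F i | i <- l]) (Pair (enc_nat R j) (Scalar c)))
    (enc_triples (fun i => enc_nat R (g i)) (fun=> enc_nat R 0) (fun=> c) l)
    (20 * (size l).+1).
Proof.
elim: l j => [|x l IH] j; first by move=> _; ev_fun; [by ev_steps|].
case=> <- gl; ev_fun; first by ev_steps; exact: (IH (g x).+1).
by rewrite /=; lia.
Qed.

Section Instance.
Variables (n m k N : nat) (G : digraph 'I_n 'I_m) (K : 'I_k -> commodity R 'I_n).
Hypotheses (nN : n <= N) (mN : m <= N) (kN : k <= N).

Definition enc_commodities (l : seq 'I_k) : value R :=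
  enc_triples (fun i => enc_nat R (source (K i))) (fun i => enc_nat R (sink (K i)))
    (fun i => demand (K i)) l.

Definition demand_at (v : nat) (i : 'I_k) : R :=
  (if v == source (K i) then demand (K i)
   else if v == sink (K i) then - demand (K i) else 0)%R.

Lemma call_demand_row v (l : seq 'I_k) : v < N ->
  call 15 (Pair (enc_nat R v) (enc_commodities l)) (enc_reals [seq demand_at v i | i <- l])
    ((size l).+1 * (28 * N + 60)).
Proof.
move=> vN; have heq (w : 'I_n) :
    call 1 (Pair (enc_nat R v) (enc_nat R w)) (enc_bool R (v == w)) (14 * N).
  by apply: call_weaken (call_eq _ _ _ _) _; lia.
elim: l => [|i l IH]; ev_fun; [by ev_steps|lia| |].
  do 4!(eapply ev_match_pair; [ev_value|]).
  eapply ev_pair; last by ev_steps; exact: IH.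
  rewrite -/(demand_at v i) /demand_at fun_if; eapply ev_if.
  - by ev_steps; exact: heq.
  - by ev_steps.
  - rewrite fun_if; eapply ev_if.
    + by ev_steps; exact: heq.
    + by rewrite -sub0r; ev_steps.
    + by ev_steps.
by rewrite /=; lia.
Qed.

Fixpoint demand_table (j : nat) : seq (nat * seq R) :=
  if j is j'.+1 then (j', row (demand_at j')) :: demand_table j' else [::].

Lemma size_demand_table j : size (demand_table j) = j.
Proof. by elim: j => //= j ->. Qed.

Lemma alookup_demand_table v j : v < j ->
  alookup v (demand_table j) = row (demand_at v).
Proof.
elim: j => //= j IH; rewrite ltnS leq_eqVlt.
by case: eqP => [-> //|_ /= /IH].
Qed.

Lemma call_demand_table j : j <= n ->
  call 16 (Pair (enc_nat R j) (enc_commodities (enum 'I_k))) (enc_assoc (demand_table j))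
    (j.+1 * (N.+1 * (28 * N + 60) + 30)).
Proof.
elim: j => [_|j IH jn]; first by ev_fun; [by ev_steps|lia].
have hr : call 15 (Pair (enc_nat R j) (enc_commodities (enum 'I_k)))
    (enc_reals (row (demand_at j))) (N.+1 * (28 * N + 60)).
  apply: call_weaken (call_demand_row _ _) _; first exact: leq_trans nN.
  by rewrite size_enum_ord leq_mul.
have {}IH := IH (ltnW jn).
ev_fun; first by ev_steps; [exact: hr|exact: IH].
by clear; lia.
Qed.

Lemma call_rows (c : 'I_m -> R) L res : size res <= 4 * N ->
  call 17 (Pair (enc_arc_seq c L) (@enc_assoc R res))
    (enc_seq [seq enc_reals (alookup a.1 res) | a : 'I_m * ('I_n * 'I_n) <- L])
    ((size L).+1 * (lookup_time N + 30)).
Proof.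
move=> sres; elim: L => [|a L IH]; first by ev_fun; [by ev_steps|lia].
have hl : call 2 (Pair (enc_nat R a.1) (enc_assoc res)) (enc_reals (alookup a.1 res)) (lookup_time N).
  by apply: call_lookup_key => //; apply: leq_trans mN.
ev_fun; first by ev_steps; [exact: hl|exact: IH].
by rewrite /=; clear; lia.
Qed.

End Instance.

End Interface.

(** * The two programs and the single-commodity instance *)

Section Mains.
Variables (R : realType).
Variables (n m k N : nat) (G : digraph 'I_n 'I_m) (K : 'I_k -> commodity R 'I_n).
Hypotheses (nN : n <= N) (mN : m <= N) (kN : k <= N).
Variables (u0 v0 : 'I_n) (c : 'I_m -> R).
Hypotheses (sp : series_parallel G u0 v0) (inst : multiflow_instance G K).
Hypothesis (c0 : forall e, (0 <= c e)%R).

Definition start_time :=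
  20 * N.+1 + N.+1 * (N.+1 * (28 * N + 60) + 30) + N.+1 * level_time N + 100.

Lemma size_arcs : size (arcs G) = m.
Proof. by rewrite size_map size_enum_ord. Qed.

Lemma sum_net_demand i : (\sum_v net_demand K v i = 0)%R.
Proof.
have [_ st _] := inst i.
rewrite (bigD1 (source (K i))) //= (bigD1 (sink (K i))) 1?eq_sym //= big1.
  by rewrite /net_demand !eqxx eq_sym (negPf st) addr0 subrr.
by move=> v /andP[/negPf vs /negPf vt]; rewrite /net_demand vs vt.
Qed.

Lemma call_start main S : difference_closed S ->
  exists2 out, solution S (arcs G) c (net_demand K) out &
    calls main 18 (enc_multiflow_instance G u0 v0 K c)
      (Pair (enc_arc_seq c (arcs G)) out) start_time.
Proof.
move=> hS.
have [||||||||out sol h] := @call_solve R main n m k N nN mN kN S (arcs G) c (net_demand K)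
    (demand_table K n) hS.
- by rewrite unzip2_arcs; apply: series_parallel_reducible sp.
- by rewrite unzip1_arcs enum_uniq.
- by rewrite size_arcs.
- by rewrite size_arcs size_demand_table; move: nN mN; clear; lia.
- move=> v; rewrite alookup_demand_table //; exact: eq_row.
- by move=> v; rewrite unzip2_arcs (series_parallel_nodes v sp).
- exact: sum_net_demand.
- by move=> a _; apply: c0.
exists out => //.
have hlab : calls main 14 (Pair Nil (enc_arcs G c)) (enc_arc_seq c (arcs G)) (20 * N.+1).
  have -> : enc_arc_seq c (arcs G) = enc_seq [seq Pair (enc_nat R e)
      (Pair (enc_nat R (arc_from G e)) (Pair (enc_nat R (arc_to G e)) (Scalar (c e)))) | e : 'I_m <- enum 'I_m].
    by rewrite /enc_arc_seq -map_comp.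
  apply: call_weaken (@call_label R main _ _ val (enum 'I_m) 0 _) _.
    by rewrite val_enum_ord size_enum_ord.
  by rewrite size_enum_ord leq_mul.
have htab : calls main 16 (Pair (enc_nat R n) (enc_commodities K (enum 'I_k)))
    (enc_assoc (demand_table K n)) (N.+1 * (N.+1 * (28 * N + 60) + 30)).
  by apply: call_weaken (call_demand_table main K nN mN kN (leqnn n)) _; rewrite leq_mul.
have {}h : calls main 12 (Pair (enc_arc_seq c (arcs G)) (enc_assoc (demand_table K n))) out
    (N.+1 * level_time N).
  by apply: call_weaken h _; rewrite size_arcs leq_mul.
ev_fun.
  do 5!(eapply ev_match_pair; [ev_value|]).
  eapply ev_let; first by ev_steps; exact: hlab.
  by ev_steps; [exact: htab|exact: h].
by rewrite /start_time; clear; lia.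
Qed.

Lemma enc_multiflow_rows X res :
  (forall a, a \in arcs G -> alookup a.1 res = row (X a.1)) ->
  enc_seq [seq enc_reals (alookup a.1 res) | a : 'I_m * ('I_n * 'I_n) <- arcs G] =
  @enc_multiflow R m k X.
Proof.
move=> h; rewrite /enc_multiflow -map_comp; congr enc_seq; apply/eq_in_map => e _ /=.
by rewrite (h _ (mem_arcs G e)) /enc_reals -map_comp.
Qed.

Definition recovery_time := start_time + N.+1 * (lookup_time N + 30) + 100.

Lemma recovery_spec (S : pred R) (f : value R) : difference_closed S ->
  (forall X, ~ (multiflow G K X /\ feasible c X)) \/
  exists X, [/\ multiflow G K X, feasible c X,
    (forall i, S (demand (K i))) -> (forall e, S (c e)) -> forall e i, S (X e i) &
    calls recovery_main 0 (Pair (enc_multiflow_instance G u0 v0 K c) f)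
      (enc_multiflow X) recovery_time].
Proof.
move=> hS; have [out sol h] := call_start recovery_main hS.
case: sol => [[_ inf]|[res [X [outE sres [fX wX] Xres SX]]]].
  left=> X [/multiflowP fX feas]; apply: (inf X fX) => a _; exact: feas.
right; exists X; split.
- exact/multiflowP.
- by move=> e; apply: (wX _ (mem_arcs G e)).
- move=> Sd Sc e i; apply: (SX _ _ _ i (mem_arcs G e)) => [v j|a _]; last exact: Sc.
  rewrite /net_demand; case: ifP => // _; case: ifP => _; last by case: hS.
  exact: difference_closedN.
- rewrite -(enc_multiflow_rows Xres).
  have hr := call_rows recovery_main nN mN kN c (arcs G) (res := res).
  have {}hr : calls recovery_main 17 (Pair (enc_arc_seq c (arcs G)) (enc_assoc res))
      (enc_seq [seq enc_reals (alookup a.1 res) | a : 'I_m * ('I_n * 'I_n) <- arcs G])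
      (N.+1 * (lookup_time N + 30)).
    apply: call_weaken (hr _) _; last by rewrite size_arcs leq_mul.
    by move: sres mN; rewrite size_arcs; clear; lia.
  rewrite outE in h; ev_fun.
    eapply ev_match_pair; [ev_value|].
    eapply ev_match_pair; first by ev_steps; exact: h.
    by ev_steps; exact: hr.
  by rewrite /recovery_time; clear; lia.
Qed.

(* The multiflow problem is solved without the help of a flow.  The single-commodity
   instance only reports whether it has been solved: the demands of the star are
   balanced iff it has.  The arc of commodity [i] carries exactly [demand (K i)], so
   that an integral flow certifies integral demands. *)
Definition star : digraph 'I_k.+1 'I_k := Digraph (lift ord0) (fun=> ord0).

Definition star_demand (r : R) (v : 'I_k.+1) : R :=
  if unlift ord0 v is Some i then demand (K i) else r.

Lemma star_outflow (f : 'I_k -> R) i : net_outflow star f (lift ord0 i) = f i.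
Proof.
rewrite /net_outflow [X in (_ - X)%R]big_pred0 => [|j]; last exact/negbTE/neq_lift.
by rewrite (big_pred1 i) ?subr0 // => j /=; rewrite (inj_eq lift_inj).
Qed.

Lemma star_outflow0 (f : 'I_k -> R) : (net_outflow star f ord0 = - \sum_i f i)%R.
Proof.
rewrite /net_outflow big_pred0 => [|j]; last by apply/negbTE; rewrite eq_sym neq_lift.
by rewrite sub0r; congr (- _)%R; apply: eq_bigl => j /=; rewrite eqxx.
Qed.

Definition reduction_time := start_time + 100 * N.+1 + 100.

Lemma reduction_spec (S : pred R) : difference_closed S ->
  exists r : R,
    ((forall X, ~ (multiflow G K X /\ feasible c X)) /\ r = 0%R \/
     (exists X, multiflow G K X /\ feasible c X) /\ r = (- \sum_i demand (K i))%R) /\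
    calls reduction_main 0 (enc_multiflow_instance G u0 v0 K c)
      (enc_flow_instance star (star_demand r) (fun=> \sum_e c e)%R) reduction_time.
Proof.
move=> hS; have [out sol h] := call_start reduction_main hS.
have hd : calls reduction_main 20 (enc_commodities K (enum 'I_k))
    (enc_seq [seq Scalar (demand (K i)) | i <- enum 'I_k]) (20 * N.+1).
  by apply: call_weaken (call_demands _ _ _ _ _) _; rewrite size_enum_ord leq_mul.
have ht : calls reduction_main 13 (enc_commodities K (enum 'I_k))
    (Scalar (\sum_i demand (K i))%R) (20 * N.+1).
  rewrite -big_enum /=.
  by apply: call_weaken (call_total _ _ _ _ _) _; rewrite size_enum_ord leq_mul.
have hc : calls reduction_main 13 (enc_arcs G c) (Scalar (\sum_e c e)%R) (20 * N.+1).
  rewrite -big_enum /=.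
  apply: call_weaken (call_total _ (fun e => enc_nat R (arc_from G e))
    (fun e => enc_nat R (arc_to G e)) c (enum 'I_m)) _; by rewrite size_enum_ord leq_mul.
have hg : calls reduction_main 19 (Pair (enc_commodities K (enum 'I_k))
     (Pair (enc_nat R 1) (Scalar (\sum_e c e)%R)))
    (enc_arcs star (fun=> \sum_e c e)%R) (20 * N.+1).
  apply: call_weaken (@call_gadget R reduction_main _ _ (fun i : 'I_k => i.+1) (enum 'I_k) 1 _ _) _.
    rewrite size_enum_ord -[1%N]addn0 iotaDl -val_enum_ord -map_comp.
    by apply: eq_map => i /=.
  by rewrite size_enum_ord leq_mul.
have encE r : enc_seq [seq Scalar (star_demand r v) | v : 'I_k.+1] =
    Pair (Scalar r) (enc_seq [seq Scalar (demand (K i)) | i <- enum 'I_k]).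
  transitivity (enc_seq (map (fun v => Scalar (star_demand r v)) (enum 'I_k.+1))); first by [].
  rewrite enum_ordSl /= /star_demand unlift_none -map_comp; congr Pair.
  by congr enc_seq; apply: eq_map => i /=; rewrite liftK.
case: sol => [[outN inf]|[res [X [outE sres [fX wX] Xres SX]]]].
  exists 0%R; split.
    left; split=> // X [/multiflowP fX feas]; apply: (inf X fX) => a _; exact: feas.
  rewrite /enc_flow_instance encE; rewrite outN in h; ev_fun.
    do 5!(eapply ev_match_pair; [ev_value|]).
    eapply ev_pair; last by ev_steps; [exact: hc|exact: hg].
    eapply ev_pair; last by ev_steps; exact: hd.
    eapply ev_match_pair; first by ev_steps; exact: h.
    by eapply ev_match_nil; [ev_value|ev_steps].
  by rewrite /reduction_time; clear; lia.
exists (- \sum_i demand (K i))%R; split.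
  right; split=> //; exists X; split; first exact/multiflowP.
  by move=> e; apply: (wX _ (mem_arcs G e)).
rewrite /enc_flow_instance encE -sub0r; rewrite outE in h.
case: res sres {outE Xres} h => [//|a res] _ h; ev_fun.
  do 5!(eapply ev_match_pair; [ev_value|]).
  eapply ev_pair; last by ev_steps; [exact: hc|exact: hg].
  eapply ev_pair; last by ev_steps; exact: hd.
  eapply ev_match_pair; first by ev_steps; exact: h.
  by eapply ev_match_pair; [ev_value|ev_steps; exact: ht].
by rewrite /reduction_time; clear; lia.
Qed.

End Mains.

(** * Polynomial bounds, output sizes and conclusion *)

Definition poly_bounded (f : nat -> nat) := exists C, forall N, 0 < N -> f N <= C * N ^ C.

Lemma poly_bounded_const a : poly_bounded (fun=> a).
Proof. by exists a => N N0; rewrite leq_pmulr // expn_gt0 N0. Qed.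

Lemma poly_bounded_id : poly_bounded id.
Proof. by exists 1 => N _; rewrite mul1n expn1. Qed.

Lemma poly_boundedD f g : poly_bounded f -> poly_bounded g ->
  poly_bounded (fun N => f N + g N).
Proof.
move=> [C fC] [D gD]; exists (C + D) => N N0; rewrite mulnDl.
by apply: leq_add; [apply: leq_trans (fC N N0) _|apply: leq_trans (gD N N0) _];
  rewrite leq_mul // leq_pexp2l // ?leq_addr ?leq_addl.
Qed.

Lemma poly_boundedM f g : poly_bounded f -> poly_bounded g ->
  poly_bounded (fun N => f N * g N).
Proof.
move=> [C fC] [D gD]; exists (C * D + (C + D)) => N N0.
apply: leq_trans (leq_mul (fC N N0) (gD N N0)) _.
rewrite mulnACA -expnD; apply: leq_mul; first exact: leq_addr.
by rewrite leq_pexp2l // leq_addl.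
Qed.

Lemma poly_boundedS f : poly_bounded f -> poly_bounded (fun N => (f N).+1).
Proof.
move=> pf; have [C fC] := poly_boundedD pf (poly_bounded_const 1).
by exists C => N /fC; rewrite addn1.
Qed.

Ltac poly := repeat match goal with
  | |- poly_bounded (fun N => addn (@?f N) (@?g N)) => apply: (@poly_boundedD f g)
  | |- poly_bounded (fun N => muln (@?f N) (@?g N)) => apply: (@poly_boundedM f g)
  | |- poly_bounded (fun N => S (@?f N)) => apply: (@poly_boundedS f)
  | |- poly_bounded (fun N => N) => exact: poly_bounded_id
  | |- poly_bounded (fun=> ?a) => exact: (poly_bounded_const a)
  end.

(** Quadratic for two reasons: a multiflow has [m * k] entries, and the star has [k] arcs with unary
    node numbers up to [k]. *)
Definition output_size N := 20 * (N.+1 * N.+1).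

Lemma times_poly_bounded :
  poly_bounded (fun N => (reduction_time N).+2 + (recovery_time N).+2 + output_size N).
Proof.
rewrite /reduction_time /recovery_time /start_time /level_time /pair_time /partner_time
  /touch_time /lookup_time /row_time /output_size.
poly.
Qed.

Section Sizes.
Variable R : realType.

Lemma size_le_value_size (s : seq (value R)) : size s <= value_size (enc_seq s).
Proof. by elim: s => //= a s IH; lia. Qed.

Lemma value_size_map (T : Type) (F : T -> value R) B (s : seq T) :
  (forall x, value_size (F x) <= B) -> value_size (enc_seq [seq F x | x <- s]) <= size s * B.+1 + 1.
Proof.
move=> h; elim: s => //= a s IH.
by move: (h a) IH; clear; lia.
Qed.

Lemma value_size_enc_nat n : value_size (enc_nat R n) = (2 * n).+1.
Proof. by elim: n => //= n; rewrite /enc_nat => ->; lia. Qed.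

End Sizes.

Section Found.
Variable R : realType.

Lemma call_runs main (input output : value R) T bound :
  calls main 0 input output T -> T.+2 <= bound -> value_size output <= bound ->
  runs (main :: library) input output bound.
Proof.
move=> h Tb sb.
have [t ht tT] := ev_call (@ev_var R main [:: input] 0 input erefl) h.
by exists t; split=> //; apply: leq_trans tT Tb.
Qed.

Section Sizes.
Variables (n m k : nat) (G : digraph 'I_n 'I_m) (u0 v0 : 'I_n).
Variables (K : 'I_k -> commodity R 'I_n) (c : 'I_m -> R).
Let N := value_size (enc_multiflow_instance G u0 v0 K c).

Lemma instance_size : [/\ n <= N, m <= N & k <= N].
Proof.
have hn := value_size_enc_nat R n.
have := size_le_value_size [seq Pair (enc_nat R (source (K i)))
  (Pair (enc_nat R (sink (K i))) (Scalar (demand (K i)))) | i <- enum 'I_k].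
rewrite size_map size_enum_ord => hk.
have := size_le_value_size [seq Pair (enc_nat R (arc_from G e))
  (Pair (enc_nat R (arc_to G e)) (Scalar (c e))) | e <- enum 'I_m].
rewrite size_map size_enum_ord => hm.
rewrite /N /enc_multiflow_instance /= -/(enc_nat R n) hn.
move: hm hk; rewrite /enc_arcs; clear.
move: (value_size _) (value_size _) (value_size _) (value_size _) => a b d e ha hb.
split; lia.
Qed.

Lemma value_size_multiflow X : value_size (@enc_multiflow R m k X) <= output_size N.
Proof.
have [_ mN kN] := instance_size.
have h e : value_size (enc_flow (X e)) <= 2 * N + 1.
  apply: leq_trans (@value_size_map R _ _ 1 (enum 'I_k) _) _ => //.
  by rewrite size_enum_ord; move: kN; clear; lia.
apply: leq_trans (@value_size_map R _ _ _ (enum 'I_m) h) _.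
rewrite size_enum_ord /output_size.
apply: leq_trans (leq_add (leq_mul mN (leqnn _)) (leqnn _)) _.
by clear; lia.
Qed.

Lemma value_size_star r x :
  value_size (enc_flow_instance (star k) (star_demand K r) (fun=> x)) <= output_size N.
Proof.
have [_ _ kN] := instance_size.
have h1 : value_size (enc_seq [seq Scalar (star_demand K r v) | v <- enum 'I_k.+1]) <= 2 * N + 3.
  apply: leq_trans (@value_size_map R _ _ 1 (enum 'I_k.+1) _) _ => //.
  by rewrite size_enum_ord; move: kN; clear; lia.
have h2 : value_size (enc_arcs (star k) (fun=> x)) <= N * (2 * N + 8) + 1.
  apply: leq_trans (@value_size_map R _ _ (2 * N + 7) (enum 'I_k) _) _ => [i|].
    rewrite /= !value_size_enc_nat /= /bump /=; move: (ltn_ord i) kN; clear; lia.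
  rewrite size_enum_ord -addnS leq_add2r; exact: leq_mul.
apply: (@leq_trans (2 * N + 3 + (N * (2 * N + 8) + 1)).+1).
  exact: leq_add h1 h2.
by rewrite /output_size; clear; lia.
Qed.

End Sizes.

(** The whole demand leaves the source, so it is bounded by the flow of the commodity summed over
    all arcs. *)
Lemma multiflow_demand_le (n m k : nat) (G : digraph 'I_n 'I_m)
    (K : 'I_k -> commodity R 'I_n) (c : 'I_m -> R) X i :
  multiflow_instance G K -> multiflow G K X -> feasible c X ->
  (demand (K i) <= \sum_e c e)%R.
Proof.
move=> inst [X0 Xb] feas; have := Xb i (source (K i)); rewrite eqxx => <-.
apply: (@le_trans _ _ (\sum_e X e i)%R).
  rewrite /net_outflow [X in (X - _)%R]big_mkcond /= lerBlDr.
  apply: (@le_trans _ _ (\sum_e X e i)%R); first by apply: ler_sum => e _; case: ifP.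
  by rewrite lerDl; apply: sumr_ge0.
apply: ler_sum => e _; apply: le_trans (feas e).
by rewrite /total_flow (bigD1 i) //= lerDl sumr_ge0.
Qed.

Lemma multiflow_demand_closed S (n m k : nat) (G : digraph 'I_n 'I_m)
    (K : 'I_k -> commodity R 'I_n) X i : difference_closed S ->
  multiflow G K X -> (forall e i, S (X e i)) -> S (demand (K i)).
Proof.
move=> hS [X0 Xb] SX; have := Xb i (source (K i)); rewrite eqxx => <-.
by apply: hS.2; rewrite big_mkcond difference_closed_sum // => e; case: ifP => _ //; case: hS.
Qed.

Lemma found_through_single_flow_closed (S : pred R) :
  difference_closed S -> found_through_single_flow S.
Proof.
move=> hS; have [C hC] := times_poly_bounded.
exists (reduction_main :: library), (recovery_main :: library), C.
move=> n m k G u0 v0 K c sp inst c0S; set I := enc_multiflow_instance _ _ _ _ _.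
have c0 e : (0 <= c e)%R by case: (c0S e).
have Sc e : S (c e) by case: (c0S e).
have [nN mN kN] := instance_size G u0 v0 K c; rewrite -/I in nN mN kN.
have {}hC : (reduction_time (value_size I)).+2 + (recovery_time (value_size I)).+2
   + output_size (value_size I) <= C * value_size I ^ C by exact: hC.
have [r [rP hP]] := reduction_spec nN mN kN sp inst c0 hS.
(* The star's capacities must lie in [S] whether or not the demands do. The sum of the given
   capacities lies in [S] and is at least every demand of a feasible multiflow. *)
have SsumC : S (\sum_e c e)%R by apply: difference_closed_sum.
have sumC0 : (0 <= \sum_e c e)%R by apply: sumr_ge0.
exists k.+1, k, (star k), (star_demand K r), (fun=> \sum_e c e)%R; split.
- apply: (call_runs hP); first by move: hC; clear; lia.
  apply: leq_trans (value_size_star G u0 v0 K c _ _) _.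
  by rewrite -/I; move: hC; clear; lia.
- by [].
- move=> [X [mX feas SX]].
  have rE : r = (- \sum_i demand (K i))%R by case: rP => [[h _]|[_ //]]; case: (h X).
  exists (fun i => demand (K i)); split=> [|i]; last exact: (multiflow_demand_closed _ hS mX SX).
  split=> [i|v].
    by rewrite (multiflow_demand_le _ inst mX feas) andbT ltW //; case: (inst i).
  rewrite /star_demand; case: unliftP => [i ->|->]; first by rewrite star_outflow.
  by rewrite star_outflow0 rE.
move=> f [f0 fb] Sf.
have fd i : f i = demand (K i).
  by have := fb (lift ord0 i); rewrite star_outflow /star_demand liftK.
have [inf|[X [mX feas SX hQ]]] := recovery_spec nN mN kN sp inst c0 (enc_flow f) hS.
  case: rP => [[_ rE]|[[X /inf //]]].
  (* In the infeasible case the centre has demand 0, while the arcs into it carry the positive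
     demands; so [k] is 0. But then the zero multiflow is feasible, a contradiction. *)
  have k0 (i : 'I_k) : False.
    have := fb ord0; rewrite star_outflow0 /star_demand unlift_none rE => /eqP.
    rewrite oppr_eq0 (bigD1 i) //= => /eqP s0.
    have [d0 _ _] := inst i.
    suff : (0 < f i + \sum_(j < k | j != i) f j)%R by rewrite s0 ltxx.
    rewrite fd ltr_pwDl //; apply: sumr_ge0 => j _; by case/andP: (f0 j).
  case: (inf (fun _ _ => 0%R)); split.
    by split=> [//|i]; case: (k0 i).
  move=> e; rewrite /total_flow big1 //.
exists X; split=> //.
(* The given flow equals the demands and lies in [S]; this supplies the condition under which the
   solver's output lies in [S]. *)
- by move=> e i; apply: SX => // j; rewrite -fd.
apply: (call_runs hQ); first by move: hC; clear; lia.
apply: leq_trans (value_size_multiflow G u0 v0 K c X) _.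
by rewrite -/I; move: hC; clear; lia.
Qed.

End Found.

Local Open Scope ring_scope.

Theorem theorem1 (R : realType) :
  (forall (V E : finType) (G : digraph V E) (u0 v0 : V)
          (k : nat) (K : 'I_k -> commodity R V) (X : E -> 'I_k -> R),
     series_parallel G u0 v0 -> multiflow_instance G K ->
     (forall i, demand (K i) \is a Num.int) ->
     multiflow G K X ->
     exists (N : nat) (lambda : 'I_N -> R) (Y : 'I_N -> E -> 'I_k -> R),
       [/\ forall j, 0 <= lambda j,
           \sum_(j < N) lambda j = 1,
           forall e, total_flow X e = \sum_(j < N) lambda j * total_flow (Y j) e,
           forall j, integer_multiflow G K (Y j) &
           forall j e, (Num.floor (total_flow X e))%:~R <= total_flow (Y j) e
                       <= (Num.ceil (total_flow X e))%:~R])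
  /\
  found_through_single_flow (fun _ : R => true)
  /\
  found_through_single_flow (fun x : R => x \is a Num.int).
Proof.
split; last split.
- by move=> V E G u0 v0 k K X sp _; apply: multiflow_rounding sp.
- by apply: found_through_single_flow_closed.
- by apply: found_through_single_flow_closed; apply: int_difference_closed.
Qed.
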